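(* Let $k$ be an algebraically closed field, let $A$ be a noetherian AS-Gorenstein Hopf $k$-algebra of finite global dimension $d$ with bijective antipode, and let $\nu$ be its Nakayama automorphism. Then for every $A$-bimodule $M$ and for all $i$, $$H^i(A,M)\cong H_{d-i}(A,{}^{\nu^{-1}}M)$$ as $k$-vector spaces.
   Context: Algebras are associative unital $k$-algebras; noetherian means left and right noetherian; $A^e=A\otimes_k A^{\mathrm{op}}$; $k$ also denotes the trivial module $A/\ker\epsilon$, $\epsilon$ the counit. AS-Gorenstein: a noetherian algebra $A$ with augmentation $\epsilon:A\to k$ is AS-Gorenstein (of injective dimension $d$) if (AS1) $\operatorname{injdim}({}_AA)=d<\infty$; (AS2) $\dim_k\operatorname{Ext}^d_A({}_Ak,{}_AA)=1$ and $\operatorname{Ext}^i_A({}_Ak,{}_AA)=0$ for all $i\ne d$; (AS3) the right-module versions hold. When the global dimension is finite it equals the injective dimension. Twisting: for a bimodule $M$ and algebra automorphisms $\sigma,\tau$, ${}^{\sigma}M^{\tau}$ is $M$ with $a\cdot m\cdot b=\sigma(a)m\tau(b)$; identity superscripts are omitted. Nakayama automorphism: an algebra automorphism $\nu$ of $A$ with $\operatorname{Ext}^i_{A^e}(A,A^e)=0$ for $i\neq d$ and $\operatorname{Ext}^d_{A^e}(A,A^e)\cong{}^1A^{\nu}$ as $A$-bimodules. For the algebras considered here it exists, is unique up to composition with inner automorphisms, and may be taken to be $\nu=S^2\xi$, where $S$ is the antipode, $\xi(a)=\sum\pi_0(a_1)a_2$, and $\pi_0:A\to k$ is the algebra homomorphism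 through which $A$ acts on the one-dimensional right module $\operatorname{Ext}^d_A({}_Ak,{}_AA)$. Hochschild (co)homology: $H_i(A,M)=\operatorname{Tor}_i^{A^e}(A,M)$ and $H^i(A,M)=\operatorname{Ext}^i_{A^e}(A,M)$. *)

(* Defs.v *)
From HB Require Import structures.
From mathcomp Require Import all_boot all_order all_algebra.
From mathcomp Require Import generic_quotient ring_quotient sesquilinear.
From mathcomp Require Import boolp classical_sets functions.
From mathcomp Require Import freeg.

Set Implicit Arguments.
Unset Strict Implicit.
Unset Printing Implicit Defensive.

Import GRing.Theory.
Local Open Scope ring_scope.
Local Open Scope quotient_scope.

(* The converse algebra: MathComp provides the ring structure of [A^c]; it is
   completed here into a [k]-algebra, so that right [A]-modules are [lmodType A^c]. *)
HB.instance Definition _ (R : pzRingType) (V : lmodType R) :=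
  GRing.Lmodule.on V^c.

Section ConverseAlgebra.
Variables (k : pzRingType) (A : algType k).

Fact converse_scalerAl (c : k) (x y : A^c) : c *: (x * y) = (c *: x : A^c) * y.
Proof. exact: (@scalerAr k A c y x). Qed.
HB.instance Definition _ :=
  GRing.Lmodule_isLalgebra.Build k A^c converse_scalerAl.

Fact converse_scalerAr (c : k) (x y : A^c) : c *: (x * y) = x * (c *: y : A^c).
Proof. exact: (@scalerAl k A c y x). Qed.
HB.instance Definition _ :=
  GRing.Lalgebra_isAlgebra.Build k A^c converse_scalerAr.
End ConverseAlgebra.

Record submodule (R : pzRingType) (V : lmodType R) := Submodule {
  submod_set :> V -> Prop;
  submod0 : submod_set 0;
  submodP : forall a u v, submod_set u -> submod_set v ->
    submod_set (a *: u + v) }.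

Section SubQuotient.
Variables (R : pzRingType) (V : lmodType R) (U : submodule V).

Definition submod_pred : {pred V} := fun x => `[< U x >].

Fact submod_pred_closed : submod_closed submod_pred.
Proof.
split=> [|a u v /asboolP Uu /asboolP Uv]; apply/asboolP; first exact: submod0.
exact: submodP.
Qed.
HB.instance Definition _ := GRing.isSubmodClosed.Build R V submod_pred
  submod_pred_closed.

Lemma submod_predP x : reflect (U x) (x \in submod_pred).
Proof. exact: asboolP. Qed.

Record submod_type := SubmodElt { submod_val : V; _ : submod_val \in submod_pred }.
HB.instance Definition _ := [isSub for submod_val].
HB.instance Definition _ := [Choice of submod_type by <:].
HB.instance Definition _ := [SubChoice_isSubLmodule of submod_type by <:].

Definition quotm := Quotient.quot submod_pred.
HB.instance Definition _ := GRing.Zmodule.on quotm.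

Definition qproj (x : V) : quotm := \pi_(Quotient.quot submod_pred) x.

Lemma qprojP (q : quotm) : exists x, qproj x = q.
Proof. by exists (repr q); rewrite /qproj reprK. Qed.

Lemma qproj_eqP x y : qproj x = qproj y <-> U (x - y).
Proof.
split=> [/eqP|Uxy]; last first.
  by apply/eqP; rewrite -Quotient.idealrBE; exact/asboolP.
by rewrite -Quotient.idealrBE => /asboolP.
Qed.

Fact qprojD x y : qproj (x + y) = qproj x + qproj y.
Proof. exact: pi_addr. Qed.

Definition qscale (a : R) (q : quotm) : quotm := qproj (a *: repr q).

Lemma qscaleE a x : qscale a (qproj x) = qproj (a *: x).
Proof.
apply/qproj_eqP; rewrite -scalerBr -[_ *: _]addr0; apply: submodP; last exact: submod0.
by apply/qproj_eqP; rewrite /qproj reprK.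
Qed.

Fact qscaleA a b q : qscale a (qscale b q) = qscale (a * b) q.
Proof. by have [x <-] := qprojP q; rewrite !qscaleE scalerA. Qed.
Fact qscale1 : left_id 1 qscale.
Proof. by move=> q; have [x <-] := qprojP q; rewrite !qscaleE scale1r. Qed.
Fact qscaleDr : right_distributive qscale +%R.
Proof.
move=> a p q; have [x <-] := qprojP p; have [y <-] := qprojP q.
by rewrite -qprojD !qscaleE -qprojD scalerDr.
Qed.
Fact qscaleDl q : {morph qscale^~ q : a b / a + b}.
Proof.
by move=> a b; have [x <-] := qprojP q; rewrite /= !qscaleE -qprojD scalerDl.
Qed.
HB.instance Definition _ :=
  GRing.Zmodule_isLmodule.Build R quotm qscaleA qscale1 qscaleDr qscaleDl.

Fact qproj_linear : linear qproj.
Proof. by move=> a x y; rewrite qprojD -qscaleE. Qed.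
HB.instance Definition _ := GRing.isLinear.Build R V quotm *:%R qproj qproj_linear.

Variables (W : lmodType R) (f : {linear V -> W}).

Definition qlift (q : quotm) : W := f (repr q).

Hypothesis fU : forall x, U x -> f x = 0.

Lemma qliftE x : qlift (qproj x) = f x.
Proof.
apply/eqP; rewrite -subr_eq0 -linearB; apply/eqP/fU/qproj_eqP.
by rewrite /qproj reprK.
Qed.

Lemma qlift_linear : linear qlift.
Proof.
move=> a p q; have [x <-] := qprojP p; have [y <-] := qprojP q.
by rewrite -linearP !qliftE linearP.
Qed.

End SubQuotient.

Section KernelImage.
Variables (R : pzRingType) (V W : lmodType R) (f : {linear V -> W}).

Fact ker0 : f 0 = 0. Proof. exact: linear0. Qed.
Fact kerP a u v : f u = 0 -> f v = 0 -> f (a *: u + v) = 0.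
Proof. by rewrite linearP => -> ->; rewrite scaler0 addr0. Qed.
Definition kernel : submodule V := Submodule ker0 kerP.

End KernelImage.

Section Homology.
Variables (R : pzRingType) (U V W : lmodType R).
Variables (f : {linear U -> V}) (g : {linear V -> W}).

Definition cycles : lmodType R := submod_type (kernel g).

Fact bnd0 : exists y, f y = submod_val (0 : cycles).
Proof. by exists 0; rewrite !linear0. Qed.
Fact bndP a (u v : cycles) : (exists y, f y = submod_val u) ->
  (exists y, f y = submod_val v) -> exists y, f y = submod_val (a *: u + v).
Proof.
by move=> [y fy] [z fz]; exists (a *: y + z); rewrite !linearP /= -fy -fz.
Qed.
Definition boundaries : submodule cycles := Submodule bnd0 bndP.

(* The homology [ker g / im f] at [V] of a complex [U --f--> V --g--> W]. *)
Definition homology : lmodType R := quotm boundaries.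

End Homology.

Section HomologyMap.
Variables (R : pzRingType) (U V W U' V' W' : lmodType R).
Variables (f : {linear U -> V}) (g : {linear V -> W}).
Variables (f' : {linear U' -> V'}) (g' : {linear V' -> W'}).
Variables (v : {linear V -> V'}) (w : {linear W -> W'}).
Hypothesis vg : forall x, w (g x) = g' (v x).

Fact cycles_map_subproof (x : cycles g) : v (submod_val x) \in submod_pred (kernel g').
Proof. by case: x => x /= /asboolP gx; apply/asboolP => /=; rewrite -vg gx linear0. Qed.
Definition cycles_map (x : cycles g) : cycles g' := SubmodElt (cycles_map_subproof x).
Fact cycles_map_linear : linear cycles_map.
Proof. by move=> a x y; apply: val_inj; rewrite /= !linearP. Qed.

(* The map induced on homology; when [f y] is sent to a boundary for every [y], it
   does not depend on the choice of representatives. *)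
Definition homology_map (h : homology f g) : homology f' g' :=
  qproj (boundaries f' g') (cycles_map (repr h)).

Lemma homology_mapE (u : {linear U -> U'}) :
  (forall x, v (f x) = f' (u x)) ->
  forall x, homology_map (qproj (boundaries f g) x) = qproj (boundaries f' g') (cycles_map x).
Proof.
move=> uf x; apply/qproj_eqP; set y := repr _.
have [z fz] : boundaries f g (y - x) by apply/qproj_eqP; rewrite /qproj reprK.
exists (u z); rewrite -uf fz.
by rewrite -(zmod_morphism_linear cycles_map_linear).
Qed.
End HomologyMap.
Arguments homology_map {R U V W U' V' W' f g} f' {g' v w} vg h.

Definition restr (S R : pzRingType) (f : {rmorphism S -> R}) (M : lmodType R) : Type := M.

Section Restriction.
Variables (S R : pzRingType) (f : {rmorphism S -> R}) (M : lmodType R).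
HB.instance Definition _ := GRing.Zmodule.on (restr f M).

Let sc (s : S) (m : restr f M) : restr f M := f s *: (m : M).
Fact restrA a b m : sc a (sc b m) = sc (a * b) m.
Proof. by rewrite /sc rmorphM scalerA. Qed.
Fact restr1 : left_id 1 sc.
Proof. by move=> m; rewrite /sc rmorph1 scale1r. Qed.
Fact restrDr : right_distributive sc +%R.
Proof. by move=> a m n; rewrite /sc scalerDr. Qed.
Fact restrDl m : {morph sc^~ m : a b / a + b}.
Proof. by move=> a b; rewrite /sc rmorphD scalerDl. Qed.
HB.instance Definition _ :=
  GRing.Zmodule_isLmodule.Build S (restr f M) restrA restr1 restrDr restrDl.

Lemma restrE (s : S) (m : restr f M) : s *: m = f s *: (m : M).
Proof. by []. Qed.
End Restriction.

(* The vector space underlying a module over a [k]-algebra. *)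
Notation kspace M := (restr (GRing.in_alg _) M).

Section Hom.
Variables (k : fieldType) (R : algType k) (M N : lmodType R).

Definition homType : Type := {linear M -> N}.
HB.instance Definition _ := gen_eqMixin homType.
HB.instance Definition _ := gen_choiceMixin homType.

Lemma hom_ext (f g : homType) : (f : {linear M -> N}) =1 (g : {linear M -> N}) -> f = g.
Proof.
case: f g => [f cf] [g cg] /= /funext fg; rewrite {}fg in cf *.
case: cf cg => -[mf] [sf] [[mg] [sg]].
by rewrite (Prop_irrelevance mf mg) (Prop_irrelevance sf sg).
Qed.

Definition hom_add (f g : homType) : homType :=
  ((f : {linear M -> N}) \+ (g : {linear M -> N}) : {linear M -> N}).
Definition hom_zero : homType := (\0 : {linear M -> N}).
Definition hom_scale_fun (c : k) (f : homType) (x : M) : N :=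
  c%:A *: (f : {linear M -> N}) x.
Fact hom_scale_linear c f : linear (hom_scale_fun c f).
Proof.
move=> a u v; rewrite /hom_scale_fun linearP scalerDr !scalerA.
by rewrite mulr_algr mulr_algl.
Qed.
HB.instance Definition _ c f :=
  GRing.isLinear.Build R M N *:%R (hom_scale_fun c f) (hom_scale_linear c f).
Definition hom_opp (f : homType) : homType := (hom_scale_fun (-1) f : {linear M -> N}).
Definition hom_scale c (f : homType) : homType := (hom_scale_fun c f : {linear M -> N}).

Fact hom_addA : associative hom_add.
Proof. by move=> f g h; apply: hom_ext => x /=; rewrite addrA. Qed.
Fact hom_addC : commutative hom_add.
Proof. by move=> f g; apply: hom_ext => x /=; rewrite addrC. Qed.
Fact hom_add0 : left_id hom_zero hom_add.
Proof. by move=> f; apply: hom_ext => x /=; rewrite add0r. Qed.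
Fact hom_addN : left_inverse hom_zero hom_opp hom_add.
Proof.
move=> f; apply: hom_ext => x /=.
by rewrite /hom_scale_fun scaleNr !scale1r scaleN1r addNr.
Qed.
HB.instance Definition _ :=
  GRing.isZmodule.Build homType hom_addA hom_addC hom_add0 hom_addN.

Fact hom_scaleA a b f : hom_scale a (hom_scale b f) = hom_scale (a * b) f.
Proof.
apply: hom_ext => x /=; rewrite /hom_scale_fun /= /hom_scale_fun scalerA.
by rewrite mulr_algl scalerA.
Qed.
Fact hom_scale1 : left_id 1 hom_scale.
Proof. by move=> f; apply: hom_ext => x /=; rewrite /hom_scale_fun !scale1r. Qed.
Fact hom_scaleDr : right_distributive hom_scale +%R.
Proof. by move=> a f g; apply: hom_ext => x /=; rewrite /hom_scale_fun scalerDr. Qed.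
Fact hom_scaleDl f : {morph hom_scale^~ f : a b / a + b}.
Proof. by move=> a b; apply: hom_ext => x /=; rewrite /hom_scale_fun !scalerDl. Qed.
HB.instance Definition _ := GRing.Zmodule_isLmodule.Build k homType
  hom_scaleA hom_scale1 hom_scaleDr hom_scaleDl.
End Hom.

Section HomMaps.
Variables (k : fieldType) (R : algType k).

Section Pre.
Variables (M M' N : lmodType R) (d : {linear M' -> M}).
Definition precomp (f : homType M N) : homType M' N :=
  ((f : {linear M -> N}) \o d : {linear M' -> N}).
Fact precomp_linear : linear precomp.
Proof. by move=> a f g; apply: hom_ext. Qed.
HB.instance Definition _ :=
  GRing.isLinear.Build k (homType M N) (homType M' N) *:%R precomp precomp_linear.
End Pre.

Section Post.
Variables (M N N' : lmodType R) (g : {linear N -> N'}).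
Definition postcomp (f : homType M N) : homType M N' :=
  (g \o (f : {linear M -> N}) : {linear M -> N'}).
Fact postcomp_linear : linear postcomp.
Proof. by move=> a f h; apply: hom_ext => x; exact: (linearP g a%:A). Qed.
HB.instance Definition _ :=
  GRing.isLinear.Build k (homType M N) (homType M N') *:%R postcomp postcomp_linear.
End Post.
End HomMaps.
Arguments precomp {k R M M'} N d f.
Arguments postcomp {k R} M {N N'} g f.

Lemma postcomp_precomp (k : fieldType) (R : algType k) (M M' N N' : lmodType R)
    (d : {linear M' -> M}) (g : {linear N -> N'}) (f : homType M N) :
  postcomp M' g (precomp N d f) = precomp N' d (postcomp M g f).
Proof. exact: hom_ext. Qed.

Section Free.
Variables (R : nzRingType) (X : choiceType).

Definition freemod : lmodType R := {freeg X / R}.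
Definition fgen (x : X) : freemod := Freeg [:: (1, x)].

Section Lift.
Variables (M : lmodType R) (f : X -> M).
Definition free_lift (u : freemod) : M := fglift f u.

Fact free_lift_linear : linear free_lift.
Proof.
have fD : {morph free_lift : u v / u + v}.
  have fB u v : free_lift (u - v) = free_lift u - free_lift v.
    exact: lift_is_additive.
  have f0 : free_lift 0 = 0 by rewrite -[in LHS](subrr 0) fB subrr.
  by move=> u v; rewrite -[v in LHS]opprK fB -[- v]sub0r fB f0 sub0r opprK.
have fS (I : Type) (s : seq I) (F : I -> freemod) :
  free_lift (\sum_(i <- s) F i) = \sum_(i <- s) free_lift (F i).
  apply: (big_morph free_lift fD).
  by rewrite /free_lift -freeg_nil fglift_Freeg prelift_nil.
move=> a u v; rewrite fD; congr (_ + _).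
have -> : free_lift u = \sum_(x <- dom u) coeff x u *: f x.
  rewrite -[in LHS](freeg_sumE u) (fS _ (dom u)).
  by apply: eq_bigr => x _; rewrite /free_lift liftU.
rewrite scaler_sumr [a *: u]/(fgscale a u) (fS _ (dom u)).
by apply: eq_bigr => x _; rewrite /free_lift liftU scalerA.
Qed.
HB.instance Definition _ := GRing.isLinear.Build R freemod M *:%R free_lift free_lift_linear.

Lemma free_liftE x : free_lift (fgen x) = f x.
Proof. by rewrite /free_lift liftU scale1r. Qed.
End Lift.

Lemma free_ext (M : lmodType R) (f g : {linear freemod -> M}) :
  (forall x, f (fgen x) = g (fgen x)) -> f =1 g.
Proof.
move=> fg u; rewrite -(freeg_sumE u) !linear_sum; apply: eq_bigr => x _.
suff -> : (Freeg [:: (coeff x u, x)] : freemod) = coeff x u *: fgen x.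
  by rewrite !linearZ fg.
by apply/eqP/freeg_eqP => y; rewrite coeffZ !coeffU mul1r.
Qed.
End Free.

Section Span.
Variables (R : pzRingType) (V : lmodType R) (G : V -> Prop).
Inductive in_span : V -> Prop :=
| Span0 : in_span 0
| SpanP a u v : G u -> in_span v -> in_span (a *: u + v).
Fact in_spanP a u v : in_span u -> in_span v -> in_span (a *: u + v).
Proof.
move=> su sv; elim: su => [|b x y Gx _ IH]; first by rewrite scaler0 add0r.
by rewrite scalerDr scalerA -addrA; exact: SpanP.
Qed.
Definition span_of : submodule V := Submodule Span0 in_spanP.

Lemma span_ker (W : lmodType R) (f : {linear V -> W}) :
  (forall x, G x -> f x = 0) -> forall x, span_of x -> f x = 0.
Proof.
move=> fG x; elim=> [|a u v Gu _ IH]; first exact: linear0.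
by rewrite linearP IH fG // scaler0 addr0.
Qed.

Lemma span_gen x : G x -> span_of x.
Proof. by move=> Gx; rewrite -[x]scale1r -[_ *: x]addr0; apply: SpanP => //; exact: Span0. Qed.
End Span.

Section Tensor.
Variables (k : fieldType) (V W : lmodType k).

Inductive tens_rel : freemod k (V * W)%type -> Prop :=
| TensRelL a v v' w : tens_rel
    (fgen k (a *: v + v', w) - (a *: fgen k (v, w) + fgen k (v', w)))
| TensRelR a v w w' : tens_rel
    (fgen k (v, a *: w + w') - (a *: fgen k (v, w) + fgen k (v, w'))).

(* [V (x)_k W]: the free space on [V * W] modulo the bilinearity relations. *)
Definition tensor := quotm (span_of tens_rel).
HB.instance Definition _ := GRing.Lmodule.on tensor.

Definition tens (v : V) (w : W) : tensor := qproj (span_of tens_rel) (fgen k (v, w)).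

Lemma tensPl w : linear (tens^~ w).
Proof.
move=> a v v'; rewrite /tens -linearP; apply/qproj_eqP.
by apply: span_gen; exact: TensRelL.
Qed.

Lemma tensPr v : linear (tens v).
Proof.
move=> a w w'; rewrite /tens -linearP; apply/qproj_eqP.
by apply: span_gen; exact: TensRelR.
Qed.

Lemma tens_bilinear : bilinear_for *:%R *:%R tens.
Proof. by split; [exact: tensPl | exact: tensPr]. Qed.

Lemma tens_ext (X : lmodType k) (f g : {linear tensor -> X}) :
  (forall v w, f (tens v w) = g (tens v w)) -> f =1 g.
Proof.
move=> fg t; have [u <-] := qprojP t.
apply: (free_ext (f := f \o qproj (span_of tens_rel))
                 (g := g \o qproj (span_of tens_rel))) => -[v w].
exact: fg.
Qed.

Lemma tensor_ind (P : tensor -> Prop) : P 0 ->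
  (forall c v w t, P t -> P (c *: tens v w + t)) -> forall t, P t.
Proof.
move=> P0 PD t; have [u <-] := qprojP t; rewrite -(freeg_sumE u).
elim: (dom u) => [|[v w] r IH]; first by rewrite big_nil linear0.
rewrite big_cons.
have -> : (Freeg [:: (coeff (v, w) u, (v, w))] : freemod k _) =
    coeff (v, w) u *: fgen k (v, w).
  by apply/eqP/freeg_eqP => y; rewrite coeffZ !coeffU mul1r.
by rewrite linearP; exact: PD.
Qed.

Section Lift.
Variables (X : lmodType k) (b : V -> W -> X).
Let b' (p : V * W) : X := b p.1 p.2.
Definition tlift (bb : bilinear_for *:%R *:%R b) : tensor -> X :=
  qlift (free_lift b').
Hypothesis bb : bilinear_for *:%R *:%R b.

Let b'_rel x : span_of tens_rel x -> free_lift b' x = 0.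
Proof.
apply: span_ker => {x} x [a v v' w|a v w w'];
  rewrite linearB linearP /= !free_liftE /b' /=.
- by rewrite (bb.1 w a v v') subrr.
- by rewrite (bb.2 v a w w') subrr.
Qed.

Fact tlift_linear : linear (tlift bb).
Proof. exact: qlift_linear b'_rel. Qed.
HB.instance Definition _ :=
  GRing.isLinear.Build k tensor X *:%R (tlift bb) tlift_linear.

Lemma tliftE v w : tlift bb (tens v w) = b v w.
Proof. by rewrite /tlift /tens (qliftE b'_rel) /= free_liftE. Qed.
End Lift.
End Tensor.

Section TensorMap.
Variables (k : fieldType) (V V' W W' : lmodType k).
Variables (f : {linear V -> V'}) (g : {linear W -> W'}).

Fact tmap_bilinear : bilinear_for *:%R *:%R (fun v w => tens (f v) (g w)).
Proof.
by split=> u a v v' /=; rewrite linearP; [exact: tensPl | exact: tensPr].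
Qed.
Definition tmap : tensor V W -> tensor V' W' := tlift tmap_bilinear.
HB.instance Definition _ := GRing.Linear.on tmap.

Lemma tmapE v w : tmap (tens v w) = tens (f v) (g w).
Proof. exact: tliftE. Qed.
End TensorMap.

Section TensorAssoc.
Variables (k : fieldType) (U V W : lmodType k).

Fact tassoc_bilinear1 (w : W) : bilinear_for *:%R *:%R
  (fun (u : U) (v : V) => tens u (tens v w)).
Proof.
split=> [v|u] a x y /=; first exact: tensPl.
by rewrite tensPl tensPr.
Qed.
Fact tassoc_bilinear : bilinear_for *:%R *:%R
  (fun t w => tlift (tassoc_bilinear1 w) t).
Proof.
split=> [w|t] a x y /=; first by rewrite linearP.
pose l w : {linear tensor U V -> tensor U (tensor V W)} :=
  tlift (tassoc_bilinear1 w).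
suff /(_ t) -> : l (a *: x + y) =1 (a \*: l x) \+ l y by [].
by apply: tens_ext => u v; rewrite /= !tliftE !tensPr.
Qed.
Definition tassoc : tensor (tensor U V) W -> tensor U (tensor V W) :=
  tlift tassoc_bilinear.
HB.instance Definition _ := GRing.Linear.on tassoc.

Lemma tassocE u v w : tassoc (tens (tens u v) w) = tens u (tens v w).
Proof. by rewrite /tassoc !tliftE. Qed.
End TensorAssoc.

(** Over a field every nonzero vector is detected by a linear form; this is
    only needed to see that the tensor product of two algebras is nonzero. *)

Section LinearForm.
Variables (k : fieldType) (V : lmodType k) (v : V).
Hypothesis v0 : v != 0.

Let avoids (U : set V) :=
  (forall a x y, U x -> U y -> U (a *: x + y)) /\ ~ U v.

Lemma linear_form_exists : exists f : {linear V -> k^o}, f v = 1.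
Proof.
have [F Favoids Ftot|U [[UP Uv] Umax]] := @Zorn_bigcup V avoids.
  split=> [a x y [X FX Xx] [Y FY Yy]|[X FX Xv]].
    have [XY|YX] := Ftot _ _ FX FY.
      by exists Y => //; apply: (Favoids _ FY).1 => //; exact: XY.
    by exists X => //; apply: (Favoids _ FX).1 => //; exact: YX.
  exact: (Favoids _ FX).2.
have Uext x : ~ U x -> exists a u, (U u \/ u = 0) /\ v = a *: x + u.
  move=> Ux; pose B : set V := fun y => exists a u, (U u \/ u = 0) /\ y = a *: x + u.
  apply: contrapT => Bv; apply: (Umax B); last first.
    split=> // a _ _ [b [u [Uu ->]]] [c [w [Uw ->]]].
    exists (a * b + c), (a *: u + w); split; last first.
      by rewrite scalerDr scalerDl scalerA addrACA.
    case: Uu Uw => [Uu|->] [Uw|->]; rewrite ?scaler0 ?add0r ?addr0; [left..|by right].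
    - exact: UP.
    - have U0 : U 0 by rewrite -(subrr u) addrC -scaleN1r; exact: UP.
      by rewrite -[_ *: _]addr0; exact: UP.
    - exact: Uw.
  split=> [y Uy|BU]; last first.
    by apply/Ux/BU; exists 1, 0; split; [right|rewrite scale1r addr0].
  by exists 0, y; split; [left|rewrite scale0r add0r].
have U0 : U 0.
  apply: contrapT => /Uext [a [u [[Uu|->]]]]; rewrite scaler0 add0r => E.
    by apply: Uv; rewrite E.
  by move: v0; rewrite E eqxx.
have UZ a x : U x -> U (a *: x) by move=> Ux; rewrite -[_ *: _]addr0; exact: UP.
have Ug x : exists c, U (x - c *: v).
  have [Ux|/Uext [a [u [Uu E]]]] := pselect (U x); first by exists 0; rewrite scale0r subr0.
  have {}Uu : U u by case: Uu => [|->].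
  have a0 : a != 0 by apply: contra_notN Uv => /eqP a0; rewrite E a0 scale0r add0r.
  exists a^-1; rewrite E scalerDr scalerA mulVf // scale1r opprD addNKr.
  by rewrite -scaleN1r; exact/UZ/UZ.
have Uuniq x c d : U (x - c *: v) -> U (x - d *: v) -> c = d.
  move=> Uc Ud; apply/eqP; rewrite -subr_eq0; apply: contra_notT Uv => cd.
  have := UZ (c - d)^-1 _ (UP (-1) _ _ Uc Ud).
  by rewrite scaleN1r opprB addrA subrK -scalerBl scalerA mulVf // scale1r.
pose f x : k^o := sval (cid (Ug x)).
have fP x : U (x - f x *: v) by exact: svalP (cid (Ug x)).
have flin : linear f.
  move=> a x y; apply: (Uuniq (a *: x + y)); first exact: fP.
  have := UP a _ _ (fP x) (fP y); congr U.
  by rewrite scalerBr scalerA addrACA -opprD -scalerDl.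
pose fL := GRing.isLinear.Build k V k^o *:%R f flin.
pose F : {linear V -> k^o} := HB.pack f fL.
exists F.
apply: (Uuniq v); first exact: fP.
by rewrite scale1r subrr.
Qed.
End LinearForm.

Section TensorAlgebra.
Variables (k : fieldType) (A B : algType k).
Local Notation T := (tensor A B).

Fact tens_mul_bilinear (a : A) (b : B) :
  bilinear_for *:%R *:%R (fun (a' : A) (b' : B) => tens (a * a') (b * b')).
Proof.
split=> u c x y /=; rewrite mulrDr -scalerAr; [exact: tensPl | exact: tensPr].
Qed.
Definition tens_mul (a : A) (b : B) : T -> T := tlift (tens_mul_bilinear a b).
HB.instance Definition _ a b := GRing.Linear.on (tens_mul a b).

Fact tmul_bilinear : bilinear_for *:%R *:%R (tens_mul : A -> B -> (T -> T)).
Proof.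
split=> [b|a] c x y; apply/funext => t /=.
  suff /(_ t) : tens_mul (c *: x + y) b =1 (c \*: tens_mul x b) \+ tens_mul y b by [].
  by apply: tens_ext => u v; rewrite /= /tens_mul !tliftE mulrDl -scalerAl tensPl.
suff /(_ t) : tens_mul a (c *: x + y) =1 (c \*: tens_mul a x) \+ tens_mul a y by [].
by apply: tens_ext => u v; rewrite /= /tens_mul !tliftE mulrDl -scalerAl tensPr.
Qed.

(* [(a (x) b) (a' (x) b') = a a' (x) b b'] *)
Definition tmul (s t : T) : T := tlift tmul_bilinear s t.

Lemma tmulE a b a' b' : tmul (tens a b) (tens a' b') = tens (a * a') (b * b').
Proof. by rewrite /tmul !tliftE /tens_mul tliftE. Qed.

Lemma tmulPl c s s' t : tmul (c *: s + s') t = c *: tmul s t + tmul s' t.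
Proof. by rewrite /tmul linearP. Qed.

Lemma tmulPr c s t t' : tmul s (c *: t + t') = c *: tmul s t + tmul s t'.
Proof.
have tmul0 u : tmul 0 u = 0 by rewrite /tmul linear0.
have tmulp a b u : tmul (tens a b) u = tens_mul a b u by rewrite /tmul tliftE.
elim/tensor_ind: s => [|d a b s IH]; first by rewrite !tmul0 scaler0 addr0.
rewrite !tmulPl IH !tmulp linearP !scalerDr !scalerA -!addrA; congr (_ + _).
  by rewrite mulrC.
by rewrite addrCA.
Qed.

Lemma tmul0l t : tmul 0 t = 0. Proof. by rewrite /tmul linear0. Qed.
Lemma tmul0r t : tmul t 0 = 0.
Proof.
have /eqP := tmulPr 1 t 0 0; rewrite !scale1r addr0.
by rewrite -subr_eq subrr eq_sym => /eqP.
Qed.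

Fact tmulA : associative tmul.
Proof.
move=> s t u; elim/tensor_ind: s => [|c a b s IHs]; first by rewrite !tmul0l.
rewrite !tmulPl IHs; congr (_ *: _ + _) => {c s IHs}.
elim/tensor_ind: t => [|c a' b' t IHt]; first by rewrite tmul0l tmul0r tmul0l.
rewrite tmulPl !tmulPr tmulPl IHt; congr (_ *: _ + _) => {c t IHt}.
elim/tensor_ind: u => [|c a'' b'' u IHu]; first by rewrite !tmul0r.
by rewrite !tmulPr IHu !tmulE !mulrA.
Qed.

Fact tmul1l : left_id (tens 1 1) tmul.
Proof.
elim/tensor_ind=> [|c a b t IH]; first by rewrite tmul0r.
by rewrite tmulPr tmulE !mul1r IH.
Qed.

Fact tmul1r : right_id (tens 1 1) tmul.
Proof.
elim/tensor_ind=> [|c a b t IH]; first by rewrite tmul0l.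
by rewrite tmulPl tmulE !mulr1 IH.
Qed.

Fact tmulDl : left_distributive tmul +%R.
Proof. by move=> s t u; have := tmulPl 1 s t u; rewrite !scale1r. Qed.

Fact tmulDr : right_distributive tmul +%R.
Proof. by move=> s t u; have := tmulPr 1 s t u; rewrite !scale1r. Qed.

Fact tens11_neq0 : tens 1 1 != 0 :> T.
Proof.
have [f f1] := linear_form_exists (oner_neq0 A).
have [g g1] := linear_form_exists (oner_neq0 B).
have fgb : bilinear_for *:%R *:%R (fun a b => f a * g b : k^o).
  split=> [b|a] c x y /=; rewrite linearP.
    by rewrite mulrDl -scalerAl.
  by rewrite mulrDr -scalerAr.
apply/eqP => /(congr1 (tlift fgb)); rewrite tliftE linear0 f1 g1 mulr1.
by apply/eqP; exact: oner_neq0.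
Qed.

HB.instance Definition _ := GRing.Zmodule_isNzRing.Build T
  tmulA tmul1l tmul1r tmulDl tmulDr tens11_neq0.

Fact tmul_scaleAl (c : k) (s t : T) : c *: (s * t) = (c *: s) * t.
Proof. by rewrite -[c *: s]addr0 [RHS]tmulPl tmul0l addr0. Qed.
HB.instance Definition _ := GRing.Lmodule_isLalgebra.Build k T tmul_scaleAl.

Fact tmul_scaleAr (c : k) (s t : T) : c *: (s * t) = s * (c *: t).
Proof. by rewrite -[c *: t]addr0 [RHS]tmulPr tmul0r addr0. Qed.
HB.instance Definition _ := GRing.Lalgebra_isAlgebra.Build k T tmul_scaleAr.

Lemma tensM a b a' b' : tens a b * tens a' b' = tens (a * a') (b * b') :> T.
Proof. exact: tmulE. Qed.
Lemma tens1 : 1 = tens 1 1 :> T. Proof. by []. Qed.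

End TensorAlgebra.

Section TensorAlgebraMap.
Variables (k : fieldType) (A A' B B' : algType k).
Variables (f : {lrmorphism A -> A'}) (g : {lrmorphism B -> B'}).

Fact tmap_monoid_morphism : monoid_morphism (tmap f g).
Proof.
pose F : {linear tensor A B -> tensor A' B'} := tmap f g.
have F0 : tmap f g 0 = 0 := linear0 F.
have FP c x y : tmap f g (c *: x + y) = c *: tmap f g x + tmap f g y := linearP F c x y.
split=> [|s t]; first by rewrite tens1 tmapE !rmorph1.
elim/tensor_ind: s => [|c a b s IHs]; first by rewrite F0 !mul0r F0.
rewrite FP !mulrDl -!scalerAl FP IHs; congr (_ *: _ + _).
elim/tensor_ind: t {c s IHs} => [|c a' b' t IHt]; first by rewrite F0 !mulr0 F0.
rewrite FP !mulrDr -!scalerAr FP IHt; congr (_ *: _ + _).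
by rewrite tensM !tmapE tensM !rmorphM.
Qed.
HB.instance Definition _ := GRing.isMonoidMorphism.Build
  (tensor A B) (tensor A' B') (tmap f g) tmap_monoid_morphism.
End TensorAlgebraMap.

Section RestrMap.
Variables (S R : pzRingType) (e : {rmorphism S -> R}) (M N : lmodType R).
Variable f : {linear M -> N}.
Definition restr_map (x : restr e M) : restr e N := f x.
Fact restr_map_linear : linear restr_map.
Proof. by move=> a x y; exact: linearP. Qed.
HB.instance Definition _ :=
  GRing.isLinear.Build S (restr e M) (restr e N) *:%R restr_map restr_map_linear.
End RestrMap.
Arguments restr_map {S R} e {M N} f x.

Section TensorOver.
Variables (k : fieldType) (R : algType k) (M : lmodType R^c) (N : lmodType R).

Inductive balance_rel : tensor (kspace M) (kspace N) -> Prop :=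
| BalanceRel (r : R) (m : M) (n : N) : balance_rel
    (tens (((r : R^c) *: m) : kspace M) (n : kspace N) -
     tens (m : kspace M) ((r *: n) : kspace N)).

(* [M (x)_R N]: the quotient of [M (x)_k N] by the relations [m r (x) n = m (x) r n]. *)
Definition tensor_over : lmodType k := quotm (span_of balance_rel).

Lemma balance_ker (X : lmodType k) (F : {linear tensor (kspace M) (kspace N) -> X}) :
  (forall (r : R) (m : M) (n : N),
     F (tens (((r : R^c) *: m) : kspace M) (n : kspace N)) =
     F (tens (m : kspace M) ((r *: n) : kspace N))) ->
  forall t, span_of balance_rel t -> F t = 0.
Proof. by move=> FE; apply: span_ker => _ [r m n]; rewrite linearB FE subrr. Qed.
End TensorOver.

Section TensorOverMap.
Variables (k : fieldType) (R : algType k) (M M' : lmodType R^c) (N : lmodType R).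
Variable f : {linear M -> M'}.

Let f1 : {linear kspace M -> kspace M'} := restr_map _ f.
Let tf : {linear tensor (kspace M) (kspace N) -> tensor_over M' N} :=
  qproj (span_of (@balance_rel k R M' N)) \o tmap f1 idfun.

Fact tensor_over_map_subproof t : span_of (@balance_rel k R M N) t -> tf t = 0.
Proof.
have tfE m n : tf (tens m n) =
    qproj (span_of (@balance_rel k R M' N)) (tens (f m : kspace M') n).
  by rewrite /tf /= tmapE.
apply: balance_ker t => r m n; rewrite !tfE linearZ.
by apply/qproj_eqP/span_gen; exact: BalanceRel.
Qed.
Definition tensor_over_map : tensor_over M N -> tensor_over M' N := qlift tf.
Fact tensor_over_map_linear : linear tensor_over_map.
Proof. exact: qlift_linear tensor_over_map_subproof. Qed.
HB.instance Definition _ := GRing.isLinear.Build k (tensor_over M N)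
  (tensor_over M' N) *:%R tensor_over_map tensor_over_map_linear.
End TensorOverMap.
Arguments tensor_over_map {k R M M'} N f t.

Section Resolutions.
Variable R : nzRingType.

Definition projective (P : lmodType R) :=
  forall (M N : lmodType R) (g : {linear M -> N}) (f : {linear P -> N}),
    (forall y, exists x, g x = y) ->
    exists h : {linear P -> M}, forall x, g (h x) = f x.

Definition injective_module (E : lmodType R) :=
  forall (M N : lmodType R) (g : {linear M -> N}) (f : {linear M -> E}),
    injective g -> exists h : {linear N -> E}, forall x, h (g x) = f x.

Record proj_resolution (M : lmodType R) := ProjResolution {
  pres :> nat -> lmodType R;
  pres_d : forall n, {linear pres n.+1 -> pres n};
  pres_aug : {linear pres 0%N -> M};
  pres_proj : forall n, projective (pres n);
  pres_aug_surj : forall y, exists x, pres_aug x = y;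
  pres_exact0 : forall x, pres_aug x = 0 <-> exists y, pres_d 0%N y = x;
  pres_exact : forall n x, pres_d n x = 0 <-> exists y, pres_d n.+1 y = x }.

Record inj_resolution (M : lmodType R) := InjResolution {
  ires :> nat -> lmodType R;
  ires_d : forall n, {linear ires n -> ires n.+1};
  ires_aug : {linear M -> ires 0%N};
  ires_inj : forall n, injective_module (ires n);
  ires_aug_inj : injective ires_aug;
  ires_exact0 : forall x, ires_d 0%N x = 0 <-> exists y, ires_aug y = x;
  ires_exact : forall n x, ires_d n.+1 x = 0 <-> exists y, ires_d n y = x }.

Definition is_zero (V : zmodType) := forall x : V, x = 0.

Definition projdim_le (M : lmodType R) (n : nat) :=
  exists P : proj_resolution M, forall i, (n < i)%N -> is_zero (P i).

Definition injdim_le (M : lmodType R) (n : nat) :=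
  exists E : inj_resolution M, forall i, (n < i)%N -> is_zero (E i).

Definition injdim_eq (M : lmodType R) (d : nat) :=
  injdim_le M d /\ forall n, injdim_le M n -> (d <= n)%N.

(* The (left) global dimension of [R] is [d]. *)
Definition gldim_eq (d : nat) :=
  (forall M : lmodType R, projdim_le M d) /\
  forall n, (forall M : lmodType R, projdim_le M n) -> (d <= n)%N.

Definition left_noetherian :=
  forall I : nat -> submodule R^o,
    (forall n x, I n x -> I n.+1 x) ->
    exists m, forall n x, (m <= n)%N -> I n x -> I m x.

(* Every module has a free resolution, whose terms are the free modules on the
   underlying sets of the successive syzygies. *)
Section FreeResolution.
Variable M : lmodType R.

Definition cover (N : lmodType R) : {linear freemod R N -> N} := free_lift idfun.

Fixpoint syzygy (n : nat) : lmodType R :=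
  if n is n'.+1 then submod_type (kernel (cover (syzygy n'))) else M.

Definition free_res (n : nat) : lmodType R := freemod R (syzygy n).
Definition free_res_d (n : nat) : {linear free_res n.+1 -> free_res n} :=
  (val : {linear submod_type (kernel (cover (syzygy n))) -> _}) \o cover (syzygy n.+1).

Lemma cover_surj (N : lmodType R) (y : N) : exists x, cover N x = y.
Proof. by exists (fgen R y); exact: free_liftE. Qed.

Lemma freemod_projective (X : choiceType) : projective (freemod R X).
Proof.
move=> N N' g f gsurj; pose h x := sval (cid (gsurj (f (fgen R x)))).
exists (free_lift h); apply: (free_ext (f := g \o free_lift h)) => x /=.
by rewrite free_liftE; exact: svalP (cid (gsurj _)).
Qed.

Lemma syzygy_im n x : cover (syzygy n) x = 0 <-> exists y, free_res_d n y = x.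
Proof.
split=> [x0|[y <-]]; last first.
  by rewrite /free_res_d /=; move: (cover _ y) => /= z; move/submod_predP: (valP z).
have xP : x \in submod_pred (kernel (cover (syzygy n))) by exact/submod_predP.
have [y yP] := cover_surj (SubmodElt xP).
by exists y; rewrite /free_res_d /= yP.
Qed.

Lemma free_res_exact n x : free_res_d n x = 0 <-> exists y, free_res_d n.+1 y = x.
Proof.
rewrite -syzygy_im; split=> [x0|x0]; first by apply: val_inj; exact: x0.
by rewrite /free_res_d /= x0.
Qed.

Definition free_resolution : proj_resolution M :=
  @ProjResolution M free_res free_res_d (cover M)
    (fun n => @freemod_projective (syzygy n)) (@cover_surj M) (@syzygy_im 0%N) free_res_exact.
End FreeResolution.

End Resolutions.

Section ExtTor.
Variables (k : fieldType) (R : algType k).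

Section Ext.
Variables (M N : lmodType R) (P : proj_resolution M).

(* [H^i(Hom_R(P, N))] *)
Definition Ext_of (i : nat) : lmodType k :=
  match i with
  | 0 => homology (\0 : {linear homType (P 0%N) N -> homType (P 0%N) N})
           (precomp N (pres_d P 0%N))
  | j.+1 => homology (precomp N (pres_d P j)) (precomp N (pres_d P j.+1))
  end.
End Ext.

Section ExtMap.
Variables (M N N' : lmodType R) (P : proj_resolution M) (g : {linear N -> N'}).

Definition Ext_of_map (i : nat) : Ext_of N P i -> Ext_of N' P i :=
  match i return Ext_of N P i -> Ext_of N' P i with
  | 0 => homology_map \0 (postcomp_precomp (pres_d P 0%N) g)
  | j.+1 => homology_map _ (postcomp_precomp (pres_d P j.+1) g)
  end.
End ExtMap.

Section Tor.
Variables (M : lmodType R^c) (N : lmodType R) (P : proj_resolution M).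

(* [H_i(P (x)_R N)] *)
Definition Tor_of (i : nat) : lmodType k :=
  match i with
  | 0 => homology (tensor_over_map N (pres_d P 0%N))
           (\0 : {linear tensor_over (P 0%N) N -> tensor_over (P 0%N) N})
  | j.+1 => homology (tensor_over_map N (pres_d P j.+1)) (tensor_over_map N (pres_d P j))
  end.
End Tor.

(* In negative degrees both are zero. *)
Definition Ext (i : int) (M N : lmodType R) : lmodType k :=
  if i is Posz n then Ext_of N (free_resolution M) n else 'rV[k]_0.

Definition Ext_map (i : int) (M N N' : lmodType R) (g : {linear N -> N'}) :
  Ext i M N -> Ext i M N' :=
  match i return Ext i M N -> Ext i M N' with
  | Posz n => @Ext_of_map M N N' (free_resolution M) g n
  | Negz _ => id
  end.

Definition Tor (i : int) (M : lmodType R^c) (N : lmodType R) : lmodType k :=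
  if i is Posz n then Tor_of N (free_resolution M) n else 'rV[k]_0.
End ExtTor.

Definition lin_iso (k : fieldType) (V W : lmodType k) :=
  exists f : {linear V -> W}, bijective f.

Section Opposite.
Variables (k : fieldType) (A B : algType k).

Definition op_mor (f : A -> B) : A^c -> B^c := f.
Variable f : {lrmorphism A -> B}.
Fact op_mor_linear : linear (op_mor f).
Proof. by move=> c x y; exact: (linearP f). Qed.
HB.instance Definition _ := GRing.isLinear.Build k A^c B^c *:%R (op_mor f) op_mor_linear.
Fact op_mor_monoid_morphism : monoid_morphism (op_mor f).
Proof. by split=> [|x y]; [exact: (rmorph1 f)|exact: (rmorphM f)]. Qed.
HB.instance Definition _ :=
  GRing.isMonoidMorphism.Build A^c B^c (op_mor f) op_mor_monoid_morphism.
End Opposite.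

Section OppositeCharacter.
Variables (k : fieldType) (A : algType k) (e : {lrmorphism A -> k^o}).

(* An algebra morphism [A -> k], and the same map on the opposite algebra, seen as
   ring morphisms onto the scalars. *)
Definition char_left (a : A) : k := e a.
Fact char_left_zmod : zmod_morphism char_left. Proof. exact: (raddfB e). Qed.
HB.instance Definition _ := GRing.isZmodMorphism.Build A k char_left char_left_zmod.
Fact char_left_monoid : monoid_morphism char_left.
Proof. by split; [exact: (rmorph1 e)|exact: (rmorphM e)]. Qed.
HB.instance Definition _ := GRing.isMonoidMorphism.Build A k char_left char_left_monoid.

Definition char_right (a : A^c) : k := e a.
Fact char_right_zmod : zmod_morphism char_right. Proof. exact: (raddfB e). Qed.
HB.instance Definition _ := GRing.isZmodMorphism.Build A^c k char_right char_right_zmod.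
Fact char_right_monoid : monoid_morphism char_right.
Proof.
by split=> [|a b]; [exact: (rmorph1 e)|rewrite mulrC; exact: (rmorphM e)].
Qed.
HB.instance Definition _ := GRing.isMonoidMorphism.Build A^c k char_right char_right_monoid.
End OppositeCharacter.

Definition noetherian (R : nzRingType) := left_noetherian R /\ left_noetherian R^c.

(* (AS1) and (AS2) for left modules over [R]; [restr e k^o] is the trivial module.
   The right-module versions are those for left modules over [A^c]. *)
Definition AS_left (k : fieldType) (R : algType k) (e : {rmorphism R -> k}) (d : nat) :=
  [/\ injdim_eq R^o d,
      lin_iso (Ext d (restr e k^o) R^o) k^o &
      forall i : nat, i <> d -> is_zero (Ext i (restr e k^o) R^o)].

Definition AS_gorenstein_dim (k : fieldType) (A : algType k)
    (e : {lrmorphism A -> k^o}) (d : nat) :=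
  @AS_left k A (char_left e) d /\ @AS_left k A^c (char_right e) d.

Definition AS_gorenstein (k : fieldType) (A : algType k) (e : {lrmorphism A -> k^o}) :=
  exists d, AS_gorenstein_dim e d.

Section Hopf.
Variables (k : fieldType) (A : algType k).

Fact counitl_bilinear (e : {lrmorphism A -> k^o}) :
  bilinear_for *:%R *:%R (fun a b : A => (e a : k) *: b).
Proof.
split=> [b|a] c x y /=; first by rewrite linearP scalerDl -scalerA.
by rewrite scalerDr !scalerA mulrC.
Qed.

Fact counitr_bilinear (e : {lrmorphism A -> k^o}) :
  bilinear_for *:%R *:%R (fun a b : A => (e b : k) *: a).
Proof.
split=> [b|a] c x y /=; last by rewrite linearP scalerDl -scalerA.
by rewrite scalerDr !scalerA mulrC.
Qed.

Fact convl_bilinear (S : {linear A -> A}) :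
  bilinear_for *:%R *:%R (fun a b : A => S a * b).
Proof.
split=> [b|a] c x y /=; first by rewrite linearP mulrDl scalerAl.
by rewrite mulrDr scalerAr.
Qed.

Fact convr_bilinear (S : {linear A -> A}) :
  bilinear_for *:%R *:%R (fun a b : A => a * S b).
Proof.
split=> [b|a] c x y /=; first by rewrite mulrDl scalerAl.
by rewrite linearP mulrDr scalerAr.
Qed.

Record hopf_structure := HopfStructure {
  comul : {lrmorphism A -> tensor A A};
  counit : {lrmorphism A -> k^o};
  antipode : {linear A -> A};
  comulA : forall a,
    tassoc (tmap comul idfun (comul a)) = tmap idfun comul (comul a);
  counitl : forall a, tlift (counitl_bilinear counit) (comul a) = a;
  counitr : forall a, tlift (counitr_bilinear counit) (comul a) = a;
  antipodel : forall a,
    tlift (convl_bilinear antipode) (comul a) = (counit a : k)%:A;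
  antipoder : forall a,
    tlift (convr_bilinear antipode) (comul a) = (counit a : k)%:A }.
End Hopf.

Section Bimodules.
Variables (k : fieldType) (A : algType k).

Definition env : algType k := tensor A A^c.

(* [A] as a left [A^e]-module: [(a (x) b) x = a x b]. *)
Definition regl : Type := A.
HB.instance Definition _ := GRing.Zmodule.on regl.

Fact regl_bilinear (x : A) :
  bilinear_for *:%R *:%R (fun (a : A) (b : A^c) => a * x * (b : A)).
Proof.
split=> [b|a] c u v /=; first by rewrite !mulrDl -!scalerAl.
by rewrite mulrDr -scalerAr.
Qed.
Definition regl_act (t : env) (x : regl) : regl := tlift (regl_bilinear x) t.

Lemma regl_actE a b x : regl_act (tens a b) x = (a : A) * x * (b : A).
Proof. exact: tliftE. Qed.
Lemma regl_actPl c s t x :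
  regl_act (c *: s + t) x = c *: (regl_act s x : A) + regl_act t x :> A.
Proof. by rewrite /regl_act linearP. Qed.
Lemma regl_act0 x : regl_act 0 x = 0.
Proof. exact: (linear0 (tlift (regl_bilinear x))). Qed.

Fact regl_actDr : right_distributive regl_act +%R.
Proof.
move=> t x y; elim/tensor_ind: t => [|c a b t IH]; first by rewrite !regl_act0 addr0.
rewrite !regl_actPl IH !regl_actE [_ * (x + y)]mulrDr mulrDl.
by rewrite scalerDr addrACA.
Qed.
Fact regl_actA s t x : regl_act s (regl_act t x) = regl_act (s * t) x.
Proof.
have act0r u : regl_act u 0 = 0.
  by have := regl_actDr u 0 0; rewrite addr0 -[X in X = _]addr0 => /addrI <-.
have actZ u c y : regl_act u (c *: (y : A)) = c *: (regl_act u y : A).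
  elim/tensor_ind: u => [|d a b u IH]; first by rewrite !regl_act0 scaler0.
  rewrite !regl_actPl IH !regl_actE -scalerAr -scalerAl scalerDr.
  by rewrite !scalerA mulrC.
elim/tensor_ind: s => [|c a b s IH]; first by rewrite mul0r !regl_act0.
rewrite mulrDl -scalerAl !regl_actPl IH; congr (_ *: _ + _) => {c s IH}.
elim/tensor_ind: t => [|c a' b' t IH]; first by rewrite mulr0 !regl_act0 act0r.
rewrite mulrDr -scalerAr !regl_actPl -IH regl_actDr actZ; congr (_ *: _ + _).
by rewrite tensM !regl_actE !mulrA.
Qed.
Fact regl_act1 : left_id 1 regl_act.
Proof. by move=> x; rewrite [LHS]regl_actE mul1r [LHS]mulr1. Qed.
Fact regl_actDl x : {morph regl_act^~ x : s t / s + t}.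
Proof. by move=> s t; have := regl_actPl 1 s t x; rewrite !scale1r. Qed.
HB.instance Definition _ :=
  GRing.Zmodule_isLmodule.Build env regl regl_actA regl_act1 regl_actDr regl_actDl.

(* [A] as a right [A^e]-module: [x (a (x) b) = b x a]. *)
Definition regr : Type := A.
HB.instance Definition _ := GRing.Zmodule.on regr.

Fact regr_bilinear (x : A) :
  bilinear_for *:%R *:%R (fun (a : A) (b : A^c) => (b : A) * x * a).
Proof.
split=> [b|a] c u v /=; first by rewrite mulrDr -scalerAr.
by rewrite !mulrDl -!scalerAl.
Qed.
Definition regr_act (t : env) (x : regr) : regr := tlift (regr_bilinear x) t.

Lemma regr_actE a b x : regr_act (tens a b) x = (b : A) * x * (a : A).
Proof. exact: tliftE. Qed.
Lemma regr_actPl c s t x :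
  regr_act (c *: s + t) x = c *: (regr_act s x : A) + regr_act t x :> A.
Proof. by rewrite /regr_act linearP. Qed.
Lemma regr_act0 x : regr_act 0 x = 0.
Proof. exact: (linear0 (tlift (regr_bilinear x))). Qed.

Fact regr_actDr : right_distributive regr_act +%R.
Proof.
move=> t x y; elim/tensor_ind: t => [|c a b t IH]; first by rewrite !regr_act0 addr0.
rewrite !regr_actPl IH !regr_actE [_ * (x + y)]mulrDr mulrDl.
by rewrite scalerDr addrACA.
Qed.
Fact regr_actA s t x : regr_act s (regr_act t x) = regr_act (t * s) x.
Proof.
have act0r u : regr_act u 0 = 0.
  by have := regr_actDr u 0 0; rewrite addr0 -[X in X = _]addr0 => /addrI <-.
have actZ u c y : regr_act u (c *: (y : A)) = c *: (regr_act u y : A).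
  elim/tensor_ind: u => [|d a b u IH]; first by rewrite !regr_act0 scaler0.
  rewrite !regr_actPl IH !regr_actE -scalerAr -scalerAl scalerDr.
  by rewrite !scalerA mulrC.
elim/tensor_ind: s => [|c a b s IH]; first by rewrite mulr0 !regr_act0.
rewrite mulrDr -scalerAr !regr_actPl IH; congr (_ *: _ + _) => {c s IH}.
elim/tensor_ind: t => [|c a' b' t IH]; first by rewrite mul0r !regr_act0 act0r.
rewrite mulrDl -scalerAl !regr_actPl -IH regr_actDr actZ; congr (_ *: _ + _).
by rewrite tensM !regr_actE !mulrA.
Qed.
Fact regr_act1 : left_id 1 regr_act.
Proof. by move=> x; rewrite [LHS]regr_actE mul1r [LHS]mulr1. Qed.
Fact regr_actDl x : {morph regr_act^~ x : s t / s + t}.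
Proof. by move=> s t; have := regr_actPl 1 s t x; rewrite !scale1r. Qed.
HB.instance Definition _ :=
  GRing.Zmodule_isLmodule.Build env^c regr regr_actA regr_act1 regr_actDr regr_actDl.

End Bimodules.

Record alg_aut (k : fieldType) (A : algType k) := AlgAut {
  aut_fun :> {lrmorphism A -> A};
  aut_inv : {lrmorphism A -> A};
  aut_funK : cancel aut_fun aut_inv;
  aut_invK : cancel aut_inv aut_fun }.

Section Hochschild.
Variables (k : fieldType) (A : algType k).
Local Notation Ae := (env A).

(* A bimodule [M] is a left [A^e]-module, with [a m b = (a (x) b) m]; in
   [twist sigma tau M], the element [a (x) b] acts as [sigma a (x) tau b]. *)
Definition env_map (sigma tau : {lrmorphism A -> A}) : {lrmorphism Ae -> Ae} :=
  @tmap k A A A^c A^c sigma (op_mor tau : {lrmorphism A^c -> A^c}).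
Definition twist (sigma tau : {lrmorphism A -> A}) (M : lmodType Ae) : lmodType Ae :=
  restr (env_map sigma tau) M.

Definition HH_coh (i : int) (M : lmodType Ae) : lmodType k := Ext i (regl A) M.
Definition HH_hom (i : int) (M : lmodType Ae) : lmodType k := Tor i (regr A) M.

Definition env_mulr (t : Ae) (x : Ae^o) : Ae^o := (x : Ae) * t.
Fact env_mulr_linear t : linear (env_mulr t).
Proof. by move=> a x y; rewrite /env_mulr mulrDl -[RHS]/(a * (x * t) + y * t) mulrA. Qed.
HB.instance Definition _ t :=
  GRing.isLinear.Build Ae Ae^o Ae^o *:%R (env_mulr t) (env_mulr_linear t).

(* [Ext^i_{A^e}(A, A^e)] is a bimodule through the right (inner) structure of
   [A^e], namely [a (x (x) y) b = x b (x) a y = (x (x) y) (b (x) a)]. *)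
Definition is_nakayama (nu : {lrmorphism A -> A}) (d : nat) :=
  (forall i : nat, i <> d -> is_zero (HH_coh i Ae^o)) /\
  exists phi : {linear HH_coh d Ae^o -> kspace (twist idfun nu (regl A))},
    bijective phi /\
    forall (a b : A) (x : HH_coh d Ae^o),
      phi (Ext_map (M := regl A) (env_mulr (tens b (a : A^c))) x) =
      tens a (b : A^c) *: (phi x : twist idfun nu (regl A)).
End Hochschild.

(* Main.v *)
From HB Require Import structures.
Require Import Defs.
From mathcomp Require Import all_boot all_order all_algebra.
From mathcomp Require Import boolp classical_sets.

(** Let [P] be a resolution of [A] by finitely generated projective [A^e]-modules
    vanishing above degree [d].  Since [Ext^i(A, A^e)] vanishes off [d], the complex
    [Hom(P, A^e)], read backwards, is a projective resolution of
    [Ext^d(A, A^e) = ^1 A^nu] by right [A^e]-modules; twisting the action by [nu^-1]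
    turns it into a resolution of [A].  As [Hom(P, A^e) (x) M = Hom(P, M)], its homology
    with coefficients in [M] is at the same time [Tor] and [Ext].

    To find [P], start from a resolution [Q] of the trivial module over the noetherian
    algebra [A], of length [d] because the [d]-th syzygy is projective, and apply the
    exact functor [Q |-> Q (x) A], where [a (q (x) y) b = a_1 q (x) a_2 y b].  It sends
    [k] to [A], and it sends [A] to [A^e] because [x (x) y |-> x_1 (x) x_2 y] is
    bijective with inverse [x (x) y |-> x_1 (x) S x_2 y]. *)

Set Implicit Arguments.
Unset Strict Implicit.
Unset Printing Implicit Defensive.

Import GRing.Theory.
Local Open Scope ring_scope.

(** * Homology and comparison of resolutions *)

(** [Ext] and [Tor] are computed from the free resolution on the underlying sets of the syzygies, in
    general neither of finite length nor finitely generated. Statements about them are moved to [P]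
    by comparison of resolutions; for the Nakayama isomorphism the effect on cocycles must be
    recorded too, since the bimodule structure lives on cochains.

    One resolution must satisfy two finiteness conditions: finite global dimension gives length [d]
    without finite generation, the noetherian hypothesis gives finite generation without a bound.
    They meet because comparison with a short resolution splits the cover of the [d]-th syzygy, and
    because a projective syzygy is covered by itself.

    The twist [nu^-1 (x) id] is applied to the scalars of both [Hom(P, A^e)] and [M]. On the first
    it turns [^1 A^nu] into [A]; in the tensor product the two twists cancel, so evaluation onto
    [Hom(P, M)] is the usual one.

    Finite generation and projectivity are carried together by dual bases: these pass to [Q (x) A]
    and to duals, and give the inverse of evaluation by a formula. *)

(** Chain maps and homotopies are built with it degree by degree, [T n] being the maps in degree [n]
    together with the invariant that permits the next step. *)
Lemma dependent_choice_seq (T : nat -> Type) (Q : forall n, T n -> T n.+1 -> Prop)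
    (t0 : T 0%N) :
  (forall n x, exists y, Q n x y) ->
  exists f : forall n, T n, f 0%N = t0 /\ forall n, Q n (f n) (f n.+1).
Proof.
move=> QT; pose f := fix f n : T n :=
  if n is m.+1 return T n then sval (cid (QT m (f m))) else t0.
by exists f; split=> // n; exact: svalP (cid (QT n (f n))).
Qed.

Lemma linear_mapP (R : pzRingType) (V W : lmodType R) (f : V -> W) :
  linear f -> exists g : {linear V -> W}, g =1 f.
Proof.
move=> lf; pose fL := GRing.isLinear.Build R V W *:%R f lf.
by exists (HB.pack f fL : {linear V -> W}).
Qed.

(* [linear0] and [linearD] at module types: with the weaker structures of the library
   versions, unification on the tensor products below takes minutes. *)
Lemma lmod_map0 (R : pzRingType) (V W : lmodType R) (f : {linear V -> W}) : f 0 = 0.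
Proof. exact: linear0. Qed.

Lemma lmod_mapD (R : pzRingType) (V W : lmodType R) (f : {linear V -> W}) x y :
  f (x + y) = f x + f y.
Proof. exact: linearD. Qed.

Lemma lmod_mapP (R : pzRingType) (V W : lmodType R) (f : {linear V -> W}) a x y :
  f (a *: x + y) = a *: f x + f y.
Proof. exact: linearP. Qed.

Lemma inverse_linear (R : pzRingType) (V W : lmodType R) (f : {linear V -> W}) :
  bijective f -> exists g : {linear W -> V}, cancel f g /\ cancel g f.
Proof.
case=> g fK gK; have [|h hE] := @linear_mapP R W V g; last first.
  by exists h; split=> x; rewrite hE.
by move=> a x y; rewrite -{1}[x]gK -{1}[y]gK -linearP fK.
Qed.

Lemma lin_iso_trans (k : fieldType) (U V W : lmodType k) :
  lin_iso U V -> lin_iso V W -> lin_iso U W.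
Proof. by move=> [f fb] [g gb]; exists (g \o f); exact: bij_comp. Qed.

Lemma lin_iso_sym (k : fieldType) (U V : lmodType k) : lin_iso U V -> lin_iso V U.
Proof. by move=> [f /inverse_linear [g [fK gK]]]; exists g; exists f. Qed.

Lemma lin_iso_zero (k : fieldType) (U V : lmodType k) :
  is_zero U -> is_zero V -> lin_iso U V.
Proof.
move=> U0 V0; exists \0; exists (fun=> 0) => x; first by rewrite [LHS]U0 [RHS]U0.
by rewrite [LHS]V0 [RHS]V0.
Qed.

Lemma lin_iso_is_zero (k : fieldType) (U V : lmodType k) :
  lin_iso U V -> is_zero V -> is_zero U.
Proof. by move=> [f [g fK _]] V0 x; rewrite -[LHS]fK -[RHS]fK [f x]V0 [f 0]V0. Qed.

Section HomologyClasses.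
Variables (R : pzRingType) (U V W : lmodType R).
Variables (f : {linear U -> V}) (g : {linear V -> W}).

Lemma cyclesP (x : cycles g) : g (submod_val x) = 0.
Proof. by move/submod_predP: (valP x). Qed.

Lemma homologyP (h : homology f g) :
  exists2 x : cycles g, qproj (boundaries f g) x = h & g (submod_val x) = 0.
Proof. by have [x <-] := qprojP h; exists x => //; exact: cyclesP. Qed.

(** Classes are handled through ambient elements, which keeps the subtype of cycles out of later
    statements. *)
Definition represents (x : V) (h : homology f g) :=
  exists2 c : cycles g, submod_val c = x & qproj (boundaries f g) c = h.

Lemma represents_exists h : exists x, represents x h.
Proof. by have [c <-] := qprojP h; exists (submod_val c), c. Qed.

Lemma cycle_represents x : g x = 0 -> exists h, represents x h.
Proof.
move=> gx; have xP : x \in submod_pred (kernel g) by exact/submod_predP.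
by exists (qproj (boundaries f g) (SubmodElt xP)), (SubmodElt xP).
Qed.

Lemma represents_linear a x y h h' : represents x h -> represents y h' ->
  represents (a *: x + y) (a *: h + h').
Proof.
move=> [c <- <-] [c' <- <-]; exists (a *: c + c') => //.
by rewrite linearP.
Qed.

Lemma represents_eqP x y h h' : represents x h -> represents y h' ->
  (h = h' <-> exists z, f z = x - y).
Proof.
by move=> [c <- <-] [c' <- <-]; exact: qproj_eqP.
Qed.

Lemma homology_zeroP : is_zero (homology f g) <->
  forall x, g x = 0 -> exists y, f y = x.
Proof.
split=> [H0 x gx|H0 h].
  have xP : x \in submod_pred (kernel g) by exact/submod_predP.
  have /qproj_eqP[y] : qproj (boundaries f g) (SubmodElt xP) = qproj _ 0.
    by rewrite linear0; exact: H0.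
  by rewrite subr0 /= => <-; exists y.
have [x <- gx] := homologyP h.
rewrite -(linear0 (qproj (boundaries f g))); apply/qproj_eqP; rewrite subr0.
by have [y fy] := H0 _ gx; exists y.
Qed.

End HomologyClasses.

Section HomologyIso.
Variables (R : pzRingType) (U V W U' V' W' : lmodType R).
Variables (f : {linear U -> V}) (g : {linear V -> W}).
Variables (f' : {linear U' -> V'}) (g' : {linear V' -> W'}).

(** Only the middle maps are data; the rest of a chain map or a homotopy enters as existence
    statements, restricted to cycles where possible. This covers homotopy equivalences, bijections,
    and degree 0, where one differential is zero. *)
Lemma homology_iso (v : {linear V -> V'}) (u : {linear V' -> V}) :
  (forall x, g x = 0 -> g' (v x) = 0) ->
  (forall y, exists z, f' z = v (f y)) ->
  (forall x, g' x = 0 -> g (u x) = 0) ->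
  (forall y, exists z, f z = u (f' y)) ->
  (forall x, g x = 0 -> exists y, f y = u (v x) - x) ->
  (forall x, g' x = 0 -> exists y, f' y = v (u x) - x) ->
  exists2 F : {linear homology f g -> homology f' g'}, bijective F &
    forall x h, represents x h -> represents (v x) (F h).
Proof.
move=> vg vf ug uf uv vu.
have cycP (x : cycles g) : v (submod_val x) \in submod_pred (kernel g').
  by apply/submod_predP/vg/cyclesP.
have cycP' (x : cycles g') : u (submod_val x) \in submod_pred (kernel g).
  by apply/submod_predP/ug/cyclesP.
pose c (x : cycles g) : cycles g' := SubmodElt (cycP x).
have [F FE] : exists F : {linear homology f g -> homology f' g'},
    forall x, F (qproj (boundaries f g) x) = qproj (boundaries f' g') (c x).
  have [|F FE] := @linear_mapP R (cycles g) (homology f' g')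
      (fun x => qproj (boundaries f' g') (c x)).
    move=> a x y; rewrite -linearP; congr qproj.
    by apply: val_inj; rewrite /= !linearP.
  have F0 x : boundaries f g x -> F x = 0.
    move=> [y fy]; rewrite FE -(linear0 (qproj (boundaries f' g'))).
    apply/qproj_eqP; rewrite subr0 /= -fy; exact: vf.
  have [|G GE] := @linear_mapP R (homology f g) (homology f' g') (qlift F).
    exact: qlift_linear F0.
  by exists G => x; rewrite GE (qliftE F0) FE.
exists F => [|_ _ [x <- <-]]; last by exists (c x).
(* Bijectivity needs only a set-theoretic inverse, so it may use a chosen representative; the choice
   changes it by a boundary, which [u] sends to a boundary. *)
exists (fun h : homology f' g' => qproj (boundaries f g) (SubmodElt (cycP' (repr h)))) => h.
  have [x <- gx] := homologyP h; rewrite FE; apply/qproj_eqP.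
  set r := repr _.
  have [y fy] : boundaries f' g' (r - c x) by apply/qproj_eqP; rewrite /qproj reprK.
  have [z fz] := uf y; have [t ft] := uv _ gx.
  by exists (z + t); rewrite /= linearD fz ft fy /= linearB /= addrA subrK.
have [x <- gx] := homologyP h; rewrite FE; apply/qproj_eqP.
set r := repr _.
have [y fy] : boundaries f' g' (r - x) by apply/qproj_eqP; rewrite /qproj reprK.
have [|t ft] := vu (submod_val r); first exact: cyclesP.
by exists (t + y); rewrite linearD ft fy /= addrA subrK.
Qed.

End HomologyIso.

Section Comparison.
Variable R : nzRingType.

(** [projective] speaks of surjective maps only; both maps are corestricted to the image of [g],
    which contains that of [f]. *)
Lemma projective_lift (P M N : lmodType R) (g : {linear M -> N}) (f : {linear P -> N}) :
  projective P -> (forall x, exists y, g y = f x) ->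
  exists h : {linear P -> M}, forall x, g (h x) = f x.
Proof.
move=> Pproj fg.
have im0 : exists y, g y = 0 by exists 0; rewrite linear0.
have imP a u v : (exists y, g y = u) -> (exists y, g y = v) -> exists y, g y = a *: u + v.
  by move=> [y <-] [z <-]; exists (a *: y + z); rewrite linearP.
pose I : submodule N := Submodule im0 imP.
have gP x : g x \in submod_pred I by apply/submod_predP; exists x.
have fP x : f x \in submod_pred I by apply/submod_predP; exact: fg.
have [|g' g'E] := @linear_mapP R M (submod_type I) (fun x => SubmodElt (gP x)).
  by move=> a x y; apply: val_inj; rewrite /= linearP.
have [|f' f'E] := @linear_mapP R P (submod_type I) (fun x => SubmodElt (fP x)).
  by move=> a x y; apply: val_inj; rewrite /= linearP.
have [|h hE] := Pproj _ _ g' f'.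
  move=> y; have /submod_predP[x gx] := valP y.
  by exists x; rewrite g'E; apply: val_inj.
by exists h => x; have := hE x; rewrite g'E f'E => /(congr1 val).
Qed.

Variable M : lmodType R.

Lemma pres_dd (P : proj_resolution M) n x : pres_d P n (pres_d P n.+1 x) = 0.
Proof. by apply/pres_exact; exists x. Qed.

Definition chain_map (P P' : proj_resolution M) (f : forall n, {linear P n -> P' n}) :=
  (forall x, pres_aug P' (f 0%N x) = pres_aug P x) /\
  forall n x, pres_d P' n (f n.+1 x) = f n (pres_d P n x).

Lemma chain_map_exists (P P' : proj_resolution M) : exists f, @chain_map P P' f.
Proof.
(* The invariant: [f] sends boundaries to boundaries, exactly what the next lift requires. *)
pose ok n (f : {linear P n -> P' n}) := forall x, exists y, pres_d P' n y = f (pres_d P n x).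
have [f0 f0E] : exists f0 : {linear P 0%N -> P' 0%N},
    forall x, pres_aug P' (f0 x) = pres_aug P x.
  by apply: (@pres_proj _ _ P 0%N); exact: pres_aug_surj.
have f0ok : ok _ f0.
  move=> x; apply/pres_exact0; rewrite f0E; apply/pres_exact0; by exists x.
pose Q n (f : {f : {linear P n -> P' n} | ok n f})
    (g : {f : {linear P n.+1 -> P' n.+1} | ok n.+1 f}) :=
  forall x, pres_d P' n (sval g x) = sval f (pres_d P n x).
have [|f [f0' fE]] := @dependent_choice_seq _ Q (exist _ f0 f0ok).
  move=> n [f fok].
  have [||g gE] := @projective_lift (P n.+1) _ _ (pres_d P' n) (f \o pres_d P n).
  - exact: pres_proj.
  - exact: fok.
  have gok : ok _ g.
    by move=> x; apply/pres_exact; rewrite gE /= pres_dd linear0.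
  by exists (exist _ g gok) => x; exact: gE.
exists (fun n => sval (f n)); split=> [x|n x]; last exact: fE.
by rewrite f0' f0E.
Qed.

Definition homotopic_id (P : proj_resolution M) (f : forall n, {linear P n -> P n}) :=
  exists s : forall n, {linear P n -> P n.+1},
    (forall x, f 0%N x - x = pres_d P 0%N (s 0%N x)) /\
    (forall n x, f n.+1 x - x = pres_d P n.+1 (s n.+1 x) + s n (pres_d P n x)).

(** The difference [g] of [f] and the identity is a chain map over zero; its contraction is lifted
    degree by degree. *)
Lemma chain_map_homotopic_id (P : proj_resolution M) f :
  @chain_map P P f -> homotopic_id f.
Proof.
move=> [fa fd].
have [g gE] : exists g : forall n, {linear P n -> P n}, forall n x, g n x = f n x - x.
  have gP n : linear (fun x => f n x - x).
    by move=> a x y; rewrite linearP scalerBr opprD addrACA.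
  by exists (fun n => sval (cid (linear_mapP (gP n)))) => n x;
    rewrite (svalP (cid (linear_mapP (gP n)))).
have gd n x : pres_d P n (g n.+1 x) = g n (pres_d P n x).
  by rewrite !gE linearB fd.
have ga x : pres_aug P (g 0%N x) = 0 by rewrite gE linearB fa subrr.
(* This makes [g x - s (d x)] a cycle in degree [n.+1], hence a boundary, so that the next [s]
   exists. *)
pose ok n (s : {linear P n -> P n.+1}) :=
  forall x, pres_d P n (s (pres_d P n x)) = g n (pres_d P n x).
have [s0 s0E] : exists s0 : {linear P 0%N -> P 1%N},
    forall x, pres_d P 0%N (s0 x) = g 0%N x.
  apply: projective_lift; first exact: pres_proj.
  by move=> x; apply/pres_exact0.
have s0ok : ok _ s0 by move=> x; rewrite s0E.
pose Q n (s : {s : {linear P n -> P n.+1} | ok n s})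
    (t : {s : {linear P n.+1 -> P n.+2} | ok n.+1 s}) :=
  forall x, pres_d P n.+1 (sval t x) = g n.+1 x - sval s (pres_d P n x).
have [|s [s0' sE]] := @dependent_choice_seq _ Q (exist _ s0 s0ok).
  move=> n [s sok].
  have [||t tE] := @projective_lift (P n.+1) _ _ (pres_d P n.+1)
      (g n.+1 \- (s \o pres_d P n)).
  - exact: pres_proj.
  - by move=> x; apply/pres_exact; rewrite /= linearB sok gd subrr.
  have tok : ok _ t.
    by move=> x; rewrite tE /= pres_dd linear0 subr0.
  by exists (exist _ t tok) => x; exact: tE.
exists (fun n => sval (s n)); split=> [x|n x]; first by rewrite s0' s0E gE.
by rewrite sE subrK gE.
Qed.

Lemma chain_map_comp (P P' P'' : proj_resolution M) f g :
  @chain_map P P' f -> @chain_map P' P'' g -> chain_map (fun n => g n \o f n).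
Proof.
move=> [fa fd] [ga gd]; split=> [x|n x] /=; first by rewrite ga fa.
by rewrite gd fd.
Qed.

Lemma comparison (P P' : proj_resolution M) : exists f g,
  [/\ @chain_map P P' f, @chain_map P' P g,
      homotopic_id (fun n => g n \o f n) & homotopic_id (fun n => f n \o g n)].
Proof.
have [f cf] := chain_map_exists P P'; have [g cg] := chain_map_exists P' P.
exists f, g; split=> //; apply: chain_map_homotopic_id; exact: chain_map_comp.
Qed.

End Comparison.

(** * Independence of Ext from the resolution *)

Section ExtComparison.
Variables (k : fieldType) (R : algType k).

Lemma hom_subE (M N : lmodType R) (f g : homType M N) x : (f - g) x = f x - g x.
Proof. by congr (_ + _); rewrite /= /hom_scale_fun !scaleN1r. Qed.

Section Ext.
Variables (M : lmodType R).

(** [Ext_of] is defined by cases on the degree, so [represents] does not apply to a variable [i];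
    the match gives statements uniform in [i]. *)
Definition ext_represents (N : lmodType R) (P : proj_resolution M) i :
    homType (P i) N -> Ext_of N P i -> Prop :=
  match i return homType (P i) N -> Ext_of N P i -> Prop with
  | 0 => fun x h => represents x h
  | j.+1 => fun x h => represents x h
  end.

Definition coboundary (N : lmodType R) (P : proj_resolution M) i :
    homType (P i) N -> Prop :=
  match i return homType (P i) N -> Prop with
  | 0 => fun x => x = 0
  | j.+1 => fun x => exists z, precomp N (pres_d P j) z = x
  end.

Lemma ext_represents_exists N (P : proj_resolution M) i (h : Ext_of N P i) :
  exists x, ext_represents x h.
Proof. by case: i h => [|i] h; exact: represents_exists. Qed.

Lemma cocycle_represents N (P : proj_resolution M) i (x : homType (P i) N) :
  precomp N (pres_d P i) x = 0 -> exists h, ext_represents x h.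
Proof. by case: i x => [|i] x; exact: cycle_represents. Qed.

Lemma ext_represents_linear N (P : proj_resolution M) i a x y (h h' : Ext_of N P i) :
  ext_represents x h -> ext_represents y h' -> ext_represents (a *: x + y) (a *: h + h').
Proof. by case: i x y h h' => [|i] x y h h'; exact: represents_linear. Qed.

Lemma ext_represents_eqP N (P : proj_resolution M) i x y (h h' : Ext_of N P i) :
  ext_represents x h -> ext_represents y h' ->
  (h = h' <-> coboundary (x - y)).
Proof.
case: i x y h h' => [|i] x y h h' hx hy; rewrite (represents_eqP hx hy) //.
by split=> [[_ /= <-]|/= ->] //; exists 0.
Qed.

Lemma ext_represents_map (N N' : lmodType R) (g : {linear N -> N'})
    (P : proj_resolution M) i x (h : Ext_of N P i) :
  ext_represents x h -> ext_represents (postcomp (P i) g x) (Ext_of_map g h).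
Proof.
case: i x h => [|i] _ _ [c <- <-].
  exists (cycles_map (postcomp_precomp (pres_d P 0%N) g) c) => //=.
  by rewrite (@homology_mapE _ _ _ _ _ _ _ _ _ _ _ _ _ _ \0) // => x; rewrite linear0.
exists (cycles_map (postcomp_precomp (pres_d P i.+1) g) c) => //=.
rewrite (@homology_mapE _ _ _ _ _ _ _ _ _ _ _ _ _ _ (postcomp _ g)) // => x.
exact: postcomp_precomp.
Qed.

(** The formula on representatives is kept because the action on [Ext] through its second argument
    will be followed across [F]. *)
Lemma Ext_of_comparison N (P P' : proj_resolution M) f g i :
  @chain_map _ _ P P' f -> @chain_map _ _ P' P g ->
  homotopic_id (fun n => g n \o f n) -> homotopic_id (fun n => f n \o g n) ->
  exists2 F : {linear Ext_of N P i -> Ext_of N P' i}, bijective F &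
    forall x h, ext_represents x h -> ext_represents (precomp N (g i) x) (F h).
Proof.
move=> [fa fd] [ga gd] [s [s0 sS]] [t [t0 tS]].
have homE (L L' : lmodType R) (x y : homType L L') : x = y -> forall z, x z = y z by move=> ->.
case: i => [|i].
  apply: (homology_iso (u := precomp N (f 0%N))) => x.
  - move=> /homE xd; apply: hom_ext => y /=; rewrite -gd; exact: xd.
  - by exists 0; rewrite !linear0.
  - move=> /homE xd; apply: hom_ext => y /=; rewrite -fd; exact: xd.
  - by exists 0; rewrite !linear0.
  - move=> /homE xd; exists 0; apply: hom_ext => y.
    rewrite hom_subE /= -linearB; have /= -> := s0 y; exact/esym/xd.
  - move=> /homE xd; exists 0; apply: hom_ext => y.
    rewrite hom_subE /= -linearB; have /= -> := t0 y; exact/esym/xd.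
apply: (homology_iso (u := precomp N (f i.+1))) => x.
- move=> /homE xd; apply: hom_ext => y /=; rewrite -gd; exact: xd.
- by exists (precomp N (g i) x); apply: hom_ext => y /=; rewrite gd.
- move=> /homE xd; apply: hom_ext => y /=; rewrite -fd; exact: xd.
- by exists (precomp N (f i) x); apply: hom_ext => y /=; rewrite fd.
- move=> /homE xd; exists (precomp N (s i) x); apply: hom_ext => y.
  rewrite hom_subE /= -linearB; have /= -> := sS i y.
  by rewrite linearD; have /= -> := xd (s i.+1 y); rewrite add0r.
- move=> /homE xd; exists (precomp N (t i) x); apply: hom_ext => y.
  rewrite hom_subE /= -linearB; have /= -> := tS i y.
  by rewrite linearD; have /= -> := xd (t i.+1 y); rewrite add0r.
Qed.

End Ext.

End ExtComparison.

(** * Elements of tensor products over an algebra, and Tor *)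

Lemma homotopy_lin_iso (k : fieldType) (U V W U' V' W' : lmodType k)
    (f : {linear U -> V}) (g : {linear V -> W})
    (f' : {linear U' -> V'}) (g' : {linear V' -> W'})
    (u : {linear U -> U'}) (v : {linear V -> V'}) (w : {linear W -> W'})
    (u' : {linear U' -> U}) (v' : {linear V' -> V}) (w' : {linear W' -> W})
    (s : {linear V -> U}) (t : {linear W -> V})
    (s' : {linear V' -> U'}) (t' : {linear W' -> V'}) :
  (forall x, f' (u x) = v (f x)) -> (forall x, g' (v x) = w (g x)) ->
  (forall x, f (u' x) = v' (f' x)) -> (forall x, g (v' x) = w' (g' x)) ->
  (forall x, v' (v x) = f (s x) + t (g x) + x) ->
  (forall x, v (v' x) = f' (s' x) + t' (g' x) + x) ->
  lin_iso (homology f g) (homology f' g').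
Proof.
move=> fu gv fu' gv' st st'.
have [x gx|y|x gx|y|x gx|x gx|F Fb _] := @homology_iso k _ _ _ _ _ _ f g f' g' v v'.
- by rewrite gv gx lmod_map0.
- by exists (u y).
- by rewrite gv' gx lmod_map0.
- by exists (u' y).
- by exists (s x); rewrite st gx lmod_map0 addr0 addrK.
- by exists (s' x); rewrite st' gx lmod_map0 addr0 addrK.
by exists F.
Qed.

Section TensorOverElements.
Variables (k : fieldType) (R : algType k) (M : lmodType R^c) (N : lmodType R).

Definition tens_over (m : M) (n : N) : tensor_over M N :=
  qproj (span_of (@balance_rel k R M N)) (tens (m : kspace M) (n : kspace N)).

Lemma tens_over_ext (X : lmodType k) (f g : {linear tensor_over M N -> X}) :
  (forall m n, f (tens_over m n) = g (tens_over m n)) -> f =1 g.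
Proof.
move=> fg t; have [u <-] := qprojP t.
exact: (tens_ext (f := f \o qproj _) (g := g \o qproj _)).
Qed.

Lemma tens_over_balanced (r : R) m n :
  tens_over ((r : R^c) *: m) n = tens_over m (r *: n).
Proof. by apply/qproj_eqP/span_gen; exact: BalanceRel. Qed.

Lemma tens_overDl n : {morph tens_over^~ n : m m' / m + m'}.
Proof.
move=> m m'; rewrite /tens_over -qprojD; congr qproj.
by have := @tensPl k (kspace M) (kspace N) n 1 m m'; rewrite !scale1r.
Qed.

Lemma tens_overDr m : {morph tens_over m : n n' / n + n'}.
Proof.
move=> n n'; rewrite /tens_over -qprojD; congr qproj.
by have := @tensPr k (kspace M) (kspace N) m 1 n n'; rewrite !scale1r.
Qed.

Lemma tens_over0l n : tens_over 0 n = 0.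
Proof. by apply: (addrI (tens_over 0 n)); rewrite -tens_overDl !addr0. Qed.

Lemma tens_over0r m : tens_over m 0 = 0.
Proof. by apply: (addrI (tens_over m 0)); rewrite -tens_overDr !addr0. Qed.

Lemma tens_over_suml n I (s : seq I) (F : I -> M) :
  tens_over (\sum_(i <- s) F i) n = \sum_(i <- s) tens_over (F i) n.
Proof. by apply: (big_morph (tens_over^~ n)) => [m m'|]; rewrite (tens_overDl, tens_over0l). Qed.

Lemma scale_tens_overr (c : k) m n : c *: tens_over m n = tens_over m (c%:A *: n).
Proof.
have := congr1 (qproj (span_of (@balance_rel k R M N)))
  (@tensPr k (kspace M) (kspace N) m c n 0).
by rewrite addr0 linearP -[X in _ + X]/(tens_over m 0) tens_over0r addr0.
Qed.

Lemma tens_over_ind (Q : tensor_over M N -> Prop) : Q 0 ->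
  (forall m n t, Q t -> Q (tens_over m n + t)) -> forall t, Q t.
Proof.
move=> Q0 QD t; have [u <-] := qprojP t.
elim/tensor_ind: u => [|c m n u IH]; first by rewrite linear0.
rewrite linearP /= -/(tens_over m n) scale_tens_overr.
exact: QD.
Qed.

(** Homogeneity is asked in the second argument only: balance moves a scalar across from the
    first. *)
Lemma tens_over_lift (X : lmodType k) (b : M -> N -> X) :
  (forall n, {morph b^~ n : m m' / m + m'}) ->
  (forall m, {morph b m : n n' / n + n'}) ->
  (forall (r : R) m n, b ((r : R^c) *: m) n = b m (r *: n)) ->
  (forall (c : k) m n, b m (c%:A *: n) = c *: b m n) ->
  exists f : {linear tensor_over M N -> X}, forall m n, f (tens_over m n) = b m n.
Proof.
move=> bDl bDr bal bZ.
have bb : bilinear_for *:%R *:%R (b : kspace M -> kspace N -> X).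
  split=> [n|m] c x y /=; first by rewrite bDl; congr (_ + _); rewrite -bZ -bal.
  by rewrite bDr; congr (_ + _); exact: bZ.
have balE t : span_of (@balance_rel k R M N) t -> tlift bb t = 0.
  by apply: balance_ker t => r m n; rewrite [LHS]tliftE [RHS]tliftE.
have [f fE] := linear_mapP (qlift_linear balE).
by exists f => m n; rewrite fE (qliftE balE); exact: tliftE.
Qed.

Lemma tensor_over_zero : is_zero M -> is_zero (tensor_over M N).
Proof.
move=> M0 t; apply: (tens_over_ext (f := idfun) (g := \0)) => m n /=.
by rewrite [m]M0 tens_over0l.
Qed.

End TensorOverElements.

Lemma tensor_over_mapE (k : fieldType) (R : algType k) (M M' : lmodType R^c)
    (N : lmodType R) (f : {linear M -> M'}) m n :
  tensor_over_map N f (tens_over m n) = tens_over (f m) n.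
Proof.
rewrite /tensor_over_map qliftE /= ?tmapE //.
exact: tensor_over_map_subproof.
Qed.

Lemma tensor_over_map0 (k : fieldType) (R : algType k) (M M' : lmodType R^c)
    (N : lmodType R) (f : {linear M -> M'}) : tensor_over_map N f 0 = 0.
Proof. exact: (lmod_map0 (tensor_over_map N f)). Qed.

Lemma tensor_over_mapD (k : fieldType) (R : algType k) (M M' : lmodType R^c)
    (N : lmodType R) (f : {linear M -> M'}) x y :
  tensor_over_map N f (x + y) = tensor_over_map N f x + tensor_over_map N f y.
Proof. exact: (lmod_mapD (tensor_over_map N f)). Qed.

Section TorComparison.
Variables (k : fieldType) (R : algType k) (M : lmodType R^c) (N : lmodType R).

(** Tensoring with [N] is additive, so it preserves the identities of a homotopy equivalence: [Tc]
    treats commuting squares, [H0] the homotopy in degree 0, [H1] the one in positive degree. *)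
Lemma Tor_of_comparison (P P' : proj_resolution M) i :
  lin_iso (Tor_of N P i) (Tor_of N P' i).
Proof.
have [f [g [[fa fd] [ga gd] [s [s0 sS]] [t [t0 tS]]]]] := comparison P P'.
have Tc (A B C D : lmodType R^c) (u : {linear A -> B}) (v : {linear B -> D})
    (u' : {linear A -> C}) (v' : {linear C -> D}) :
    (forall x, v (u x) = v' (u' x)) -> forall x,
    tensor_over_map N v (tensor_over_map N u x) = tensor_over_map N v' (tensor_over_map N u' x).
  move=> uv; elim/tens_over_ind=> [|m n x IH]; first by rewrite !tensor_over_map0.
  by rewrite !tensor_over_mapD IH !tensor_over_mapE uv.
have H0 (A B C : lmodType R^c) (u : {linear A -> B}) (v : {linear B -> A})
    (d : {linear C -> A}) (w : {linear A -> C}) :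
    (forall x, v (u x) - x = d (w x)) -> forall x,
    tensor_over_map N v (tensor_over_map N u x) = tensor_over_map N d (tensor_over_map N w x) + x.
  move=> uv; elim/tens_over_ind=> [|m n x IH]; first by rewrite !tensor_over_map0 addr0.
  rewrite !tensor_over_mapD IH !tensor_over_mapE -uv.
  by rewrite addrACA -tens_overDl subrK.
have H1 (A B C D : lmodType R^c) (u : {linear A -> B}) (v : {linear B -> A})
    (d : {linear C -> A}) (w : {linear A -> C}) (d' : {linear D -> A}) (w' : {linear A -> D}) :
    (forall x, v (u x) - x = d (w x) + d' (w' x)) -> forall x,
    tensor_over_map N v (tensor_over_map N u x) =
    tensor_over_map N d (tensor_over_map N w x) + tensor_over_map N d' (tensor_over_map N w' x) + x.
  move=> uv; elim/tens_over_ind=> [|m n x IH]; first by rewrite !tensor_over_map0 !addr0.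
  rewrite !tensor_over_mapD IH !tensor_over_mapE -(subrK m (v (u m))) uv !tens_overDl.
  rewrite -!addrA; congr (_ + _); rewrite [RHS]addrCA; congr (_ + _).
  by rewrite addrCA; congr (_ + _); rewrite addrCA.
pose T (Q : lmodType R^c) : lmodType k := tensor_over Q N.
pose Tm (A B : lmodType R^c) (u : {linear A -> B}) : {linear T A -> T B} :=
  tensor_over_map N u.
case: i => [|i].
  apply: (@homotopy_lin_iso k (T (P 1%N)) (T (P 0%N)) (T (P 0%N))
    (T (P' 1%N)) (T (P' 0%N)) (T (P' 0%N)) (Tm _ _ (pres_d P 0%N)) \0
    (Tm _ _ (pres_d P' 0%N)) \0 (Tm _ _ (f 1%N)) (Tm _ _ (f 0%N)) \0
    (Tm _ _ (g 1%N)) (Tm _ _ (g 0%N)) \0 (Tm _ _ (s 0%N)) \0 (Tm _ _ (t 0%N)) \0).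
  - by apply: Tc; exact: fd.
  - by [].
  - by apply: Tc; exact: gd.
  - by [].
  - by move=> x; apply: etrans (H0 _ _ _ _ _ _ _ s0 x) _; congr (_ + _); exact/esym/addr0.
  - by move=> x; apply: etrans (H0 _ _ _ _ _ _ _ t0 x) _; congr (_ + _); exact/esym/addr0.
apply: (@homotopy_lin_iso k (T (P i.+2)) (T (P i.+1)) (T (P i))
  (T (P' i.+2)) (T (P' i.+1)) (T (P' i)) (Tm _ _ (pres_d P i.+1)) (Tm _ _ (pres_d P i))
  (Tm _ _ (pres_d P' i.+1)) (Tm _ _ (pres_d P' i)) (Tm _ _ (f i.+2)) (Tm _ _ (f i.+1))
  (Tm _ _ (f i)) (Tm _ _ (g i.+2)) (Tm _ _ (g i.+1)) (Tm _ _ (g i))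
  (Tm _ _ (s i.+1)) (Tm _ _ (s i)) (Tm _ _ (t i.+1)) (Tm _ _ (t i))).
- by apply: Tc; exact: fd.
- by apply: Tc; exact: fd.
- by apply: Tc; exact: gd.
- by apply: Tc; exact: gd.
- exact: H1 (sS i).
- exact: H1 (tS i).
Qed.

End TorComparison.

(** * Finitely generated projective resolutions *)

Section DualBasis.
Variable R : nzRingType.

(* Equivalent to [P] being finitely generated and projective. *)
Definition dual_basis (P : lmodType R) := exists n (p : 'I_n -> P)
  (f : 'I_n -> {linear P -> R^o}), forall x, x = \sum_i (f i x : R) *: p i.

Lemma dual_basis_projective (P : lmodType R) : dual_basis P -> projective P.
Proof.
move=> [n [p [f pf]]] M N g h gsurj.
pose y i := sval (cid (gsurj (h (p i)))).
have [|l lE] := @linear_mapP R P M (fun x => \sum_i (f i x : R) *: y i).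
  move=> a u v; rewrite scaler_sumr -big_split; apply: eq_bigr => i _ /=.
  by rewrite linearP scalerDl scalerA.
exists l => x; rewrite lE linear_sum [in RHS](pf x) linear_sum.
by apply: eq_bigr => i _; rewrite !linearZ (svalP (cid (gsurj (h (p i))))).
Qed.

Lemma dual_basis_retract (P Q : lmodType R) (s : {linear P -> Q}) (r : {linear Q -> P}) :
  (forall x, r (s x) = x) -> dual_basis Q -> dual_basis P.
Proof.
move=> rs [n [p [f pf]]]; exists n, (r \o p), (fun i => f i \o s) => x /=.
rewrite -[LHS]rs [in LHS](pf (s x)) linear_sum.
by apply: eq_bigr => i _; rewrite linearZ.
Qed.

Lemma dual_basis_zero (P : lmodType R) : is_zero P -> dual_basis P.
Proof.
move=> P0; exists 0%N, (fun=> 0), (fun=> \0) => x; by rewrite [LHS]P0 [RHS]P0.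
Qed.

Lemma sum_delta (V : lmodType R) n (g : 'I_n -> V) j :
  \sum_i (i == j)%:R *: g i = g j.
Proof.
rewrite (bigD1 j) //= eqxx scale1r big1 ?addr0 // => i /negPf->.
by rewrite scale0r.
Qed.

Lemma dual_basis_free n : dual_basis (freemod R 'I_n).
Proof.
pose f i : {linear freemod R 'I_n -> R^o} := free_lift (fun j => (i == j)%:R : R^o).
exists n, (fun i => fgen R i), f.
have [|l lE] := @linear_mapP R (freemod R 'I_n) (freemod R 'I_n)
    (fun x => \sum_i (f i x : R) *: fgen R i).
  move=> a u v; rewrite scaler_sumr -big_split; apply: eq_bigr => i _ /=.
  by rewrite linearP scalerDl scalerA.
move=> x; rewrite -lE; apply: (free_ext (f := idfun)) => j /=.
rewrite lE -[LHS](sum_delta (fun i => fgen R i) j).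
by apply: eq_bigr => i _; have -> : f i (fgen R j) = (i == j)%:R by exact: free_liftE.
Qed.

Lemma projective_retract (P Q : lmodType R) (s : {linear P -> Q}) (r : {linear Q -> P}) :
  (forall x, r (s x) = x) -> projective Q -> projective P.
Proof.
move=> rs Qproj M N g h gsurj; have [l lE] := Qproj _ _ g (h \o r) gsurj.
by exists (l \o s) => x /=; rewrite lE /= rs.
Qed.

End DualBasis.

Section FinitelyGenerated.
Variable R : nzRingType.

Definition seq_span (V : lmodType R) (s : seq V) (x : V) := in_span (fun y => y \in s) x.

Lemma seq_span_sub (V : lmodType R) (s : seq V) (U : submodule V) x :
  (forall y, y \in s -> U y) -> seq_span s x -> U x.
Proof. by move=> sU; elim=> [|a u v us _ IH]; [exact: submod0|apply: submodP => //; exact: sU]. Qed.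

Lemma seq_span_gen (V : lmodType R) (s : seq V) x : x \in s -> seq_span s x.
Proof. exact: (span_gen (G := fun y => y \in s)). Qed.

Lemma seq_span_incl (V : lmodType R) (s t : seq V) x :
  {subset s <= t} -> seq_span s x -> seq_span t x.
Proof.
move=> st; apply: (@seq_span_sub V s (span_of (fun y => y \in t))) => y /st.
exact: seq_span_gen.
Qed.

Lemma seq_span_cons (V : lmodType R) (s : seq V) x u : seq_span (x :: s) u ->
  exists a v, seq_span s v /\ u = a *: x + v.
Proof.
elim=> [|a w v ws _ [b [z [sz ->]]]].
  by exists 0, 0; split; [exact: Span0|rewrite scale0r addr0].
move: ws; rewrite inE => /orP[/eqP->|ws].
  by exists (a + b), z; rewrite scalerDl addrA.
by exists b, (a *: w + z); split; [exact: SpanP|rewrite addrCA].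
Qed.

Definition fg_submod (V : lmodType R) (U : V -> Prop) :=
  exists s : seq V, (forall x, x \in s -> U x) /\ forall x, U x -> seq_span s x.

Definition fg_module (V : lmodType R) := exists s : seq V, forall x, seq_span s x.

Hypothesis noeth : left_noetherian R.

(** Otherwise finite lists in [I] could be extended for ever, each spanning strictly more than the
    one before, against the ascending chain condition. *)
Lemma noetherian_ideal_fg (I : submodule R^o) : fg_submod I.
Proof.
apply: contrapT => nfg.
pose T (n : nat) := {s : seq R^o | forall x, x \in s -> I x}.
have ex (n : nat) (s : T n) : exists t : T n.+1,
    {subset sval s <= sval t} /\ exists2 x, x \in sval t & ~ seq_span (sval s) x.
  apply: contrapT => nt; apply: nfg; exists (sval s); split=> [|x Ix]; first exact: (svalP s).
  apply: contrapT => sx; apply: nt.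
  have tI y : y \in x :: sval s -> I y.
    by rewrite inE => /orP[/eqP->//|]; exact: (svalP s).
  exists (exist _ (x :: sval s) tI); split=> [y ys|]; first by rewrite inE ys orbT.
  by exists x => //=; rewrite mem_head.
have n0 : forall x : R^o, x \in [::] -> I x by [].
have [f [_ fE]] := dependent_choice_seq (exist _ [::] n0 : T 0%N) ex.
have [|m mE] := noeth (I := fun n => span_of (fun y => y \in sval (f n))).
  by move=> n x; exact: (seq_span_incl (fE n).1).
have [_ [x xf xn]] := fE m.
by apply: xn; apply: (mE m.+1) => //; exact: seq_span_gen.
Qed.

(** Induction on the generators, as for Hilbert's argument: lifts of generators of an ideal of
    leading coefficients, together with generators of the part of [U] in the span of the remaining
    generators. *)
Lemma noetherian_submod_fg (V : lmodType R) (s : seq V) (U : submodule V) :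
  (forall x, U x -> seq_span s x) -> fg_submod U.
Proof.
elim: s U => [|x s IH] U Us; first by exists [::].
have I0 : exists v, seq_span s v /\ U (0 *: x + v).
  by exists 0; split; [exact: Span0|rewrite scale0r addr0; exact: submod0].
have IP (a u v : R^o) : (exists w, seq_span s w /\ U ((u : R) *: x + w)) ->
    (exists w, seq_span s w /\ U ((v : R) *: x + w)) ->
    exists w, seq_span s w /\ U ((a *: u + v : R) *: x + w).
  move=> [w [sw Uw]] [z [sz Uz]]; exists (a *: w + z); split; first exact: in_spanP.
  have := submodP a Uw Uz; congr (submod_set U _).
  by rewrite scalerDr scalerA addrACA -scalerDl.
(* The ideal of the coefficients that [x] can have in elements of [U]. *)
pose I := @Submodule R R^o (fun a => exists v, seq_span s v /\ U ((a : R) *: x + v)) I0 IP.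
have [l [lI Il]] := noetherian_ideal_fg I.
have [v vE] : exists v : R -> V, forall a, I a -> seq_span s (v a) /\ U (a *: x + v a).
  have [a|v vE] := choice (P := fun a v => I a -> seq_span s v /\ U (a *: x + v)).
    have [[v vP]|nI] := pselect (I a); first by exists v.
    by exists 0 => /nI.
  by exists v.
have U0 : U 0 /\ seq_span s 0 by split; [exact: submod0|exact: Span0].
have UP a u w : U u /\ seq_span s u -> U w /\ seq_span s w ->
    U (a *: u + w) /\ seq_span s (a *: u + w).
  by move=> [Uu su] [Uw sw]; split; [exact: submodP|exact: in_spanP].
have [|l' [lU Ul]] := IH (Submodule U0 UP); first by move=> y [].
pose L := [seq (a : R) *: x + v a | a <- l] ++ l'.
have LU y : y \in L -> U y.
  rewrite mem_cat => /orP[/mapP[a /lI/vE[_ Ua] ->]//|/lU[]//].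
exists L; split=> // u Uu; have [a [w [sw uE]]] := seq_span_cons (Us _ Uu).
have Ia : seq_span l a by apply: Il; exists w; rewrite -uE.
(* [y] has the same coefficient [a] as [u], so [u - y] lies in [U] and in the span of [s], where the
   generators [l'] take over. *)
have [y [Ly [z [sz yE]]]] : exists y, seq_span L y /\ exists z, seq_span s z /\ y = a *: x + z.
  elim: Ia {uE} => [|b c e lc _ [y [Ly [z [sz yE]]]]].
    by exists 0; split; [exact: Span0|exists 0; rewrite scale0r addr0; split=> //; exact: Span0].
  exists (b *: (c *: x + v c) + y); split.
    apply: SpanP; last by [].
    by rewrite mem_cat; apply/orP; left; apply/mapP; exists c.
  exists (b *: v c + z); split; first by apply: in_spanP => //; exact: (vE _ (lI _ lc)).1.
  by rewrite yE scalerDr scalerA addrACA -scalerDl.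
have -> : u = 1 *: (u - y) + y by rewrite scale1r subrK.
apply: in_spanP => //; apply: (@seq_span_incl _ l') => [e el|]; first by rewrite mem_cat el orbT.
apply: Ul; split.
  rewrite addrC -scaleN1r; apply: submodP; last exact: Uu.
  exact: seq_span_sub Ly.
by rewrite uE yE opprD addrACA subrr add0r addrC -scaleN1r; exact: in_spanP.
Qed.

Lemma fg_submod_module (V : lmodType R) (U : submodule V) :
  fg_submod U -> fg_module (submod_type U).
Proof.
move=> [s [sU Us]]; exists (pmap insub s) => x.
suff H y : seq_span s y -> forall z : submod_type U, submod_val z = y ->
    seq_span (pmap insub s : seq (submod_type U)) z.
  by apply: H (erefl _); apply: Us; move/submod_predP: (valP x).
elim=> [|a u v us sv IH] z zE.
  by have -> : z = 0 by [apply: val_inj]; exact: Span0.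
have uU : u \in submod_pred U by apply/submod_predP/sU.
have vU : v \in submod_pred U by apply/submod_predP; exact: seq_span_sub sv.
have -> : z = a *: SubmodElt uU + SubmodElt vU by apply: val_inj.
apply: SpanP; last exact: IH.
by rewrite mem_pmap; apply/mapP; exists u => //; rewrite insubT.
Qed.

Lemma dual_basis_fg (P : lmodType R) : dual_basis P -> fg_module P.
Proof.
move=> [n [p [f pf]]]; exists (codom p) => x; rewrite [x]pf.
elim: (index_enum _) => [|i r IH]; first by rewrite big_nil; exact: Span0.
by rewrite big_cons; apply: SpanP => //; exact: codom_f.
Qed.

(** A projective [N] is covered by itself, with a dual basis obtained by splitting a finite free
    cover. The kernel is then zero, which makes the resolution stop at the first projective
    syzygy. *)
Lemma fg_cover (N : lmodType R) : fg_module N ->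
  exists (C : lmodType R) (c : {linear C -> N}),
    [/\ dual_basis C, forall y, exists x, c x = y & projective N -> injective c].
Proof.
move=> [s sN].
have [c cs] : exists c : {linear freemod R 'I_(size s) -> N}, forall y, exists x, c x = y.
  exists (free_lift (fun i : 'I_(size s) => nth 0 s i)) => y; elim: (sN y) => [|a u v us _ [x xE]].
    by exists 0; rewrite linear0.
  move: us; rewrite -index_mem => us.
  exists (a *: fgen R (Ordinal us) + x); rewrite linearP xE; congr (_ *: _ + _).
  by apply: etrans (free_liftE _ _) _; rewrite /= nth_index // -index_mem.
have [Nproj|Nnproj] := pselect (projective N); last first.
  by exists (freemod R 'I_(size s)), c; split=> //; exact: dual_basis_free.
exists N, idfun; split=> [|y|_ x y] //; last by exists y.
have [h hE] := Nproj _ _ c idfun cs.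
exact: dual_basis_retract hE (dual_basis_free _ _).
Qed.

End FinitelyGenerated.

Section FiniteResolution.
Variables (R : nzRingType) (noeth : left_noetherian R).

(** Bundling makes the passage to the next syzygy an endofunction, which can be iterated. *)
Record fg_lmod := FgLmod { fg_carrier : lmodType R; fg_lmodP : fg_module fg_carrier }.

Definition fg_cover_dom (N : fg_lmod) : lmodType R := sval (cid (fg_cover (fg_lmodP N))).
Definition fg_cover_map (N : fg_lmod) : {linear fg_cover_dom N -> fg_carrier N} :=
  sval (cid (svalP (cid (fg_cover (fg_lmodP N))))).

Lemma fg_cover_mapP (N : fg_lmod) :
  [/\ dual_basis (fg_cover_dom N), forall y, exists x, fg_cover_map N x = y &
      projective (fg_carrier N) -> injective (fg_cover_map N)].
Proof. exact: svalP (cid (svalP (cid (fg_cover (fg_lmodP N))))). Qed.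

Lemma fg_kernel (N : fg_lmod) : fg_module (submod_type (kernel (fg_cover_map N))).
Proof.
have [/dual_basis_fg[s sC] _ _] := fg_cover_mapP N.
by apply: fg_submod_module; apply: (noetherian_submod_fg noeth (s := s)) => x _.
Qed.

Variable M : fg_lmod.

Definition fg_syzygy n : fg_lmod := iter n (fun N => FgLmod (fg_kernel N)) M.
Definition fg_res n := fg_cover_dom (fg_syzygy n).
Definition fg_res_d n : {linear fg_res n.+1 -> fg_res n} :=
  (val : {linear submod_type (kernel (fg_cover_map (fg_syzygy n))) -> _})
    \o fg_cover_map (fg_syzygy n.+1).

Lemma fg_syzygy_im n x : fg_cover_map (fg_syzygy n) x = 0 <-> exists y, fg_res_d n y = x.
Proof.
have [_ csurj _] := fg_cover_mapP (fg_syzygy n.+1).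
split=> [x0|[y <-]]; last first.
  by rewrite /fg_res_d /=; move: (fg_cover_map _ y) => /= z; move/submod_predP: (valP z).
have xP : x \in submod_pred (kernel (fg_cover_map (fg_syzygy n))) by exact/submod_predP.
have [y yP] := csurj (SubmodElt xP).
by exists y; rewrite /fg_res_d /= yP.
Qed.

Lemma fg_res_exact n x : fg_res_d n x = 0 <-> exists y, fg_res_d n.+1 y = x.
Proof.
rewrite -fg_syzygy_im; split=> [x0|x0]; first by apply: val_inj; exact: x0.
by rewrite /fg_res_d /= x0.
Qed.

Definition fg_resolution : proj_resolution (fg_carrier M).
Proof.
apply: (@ProjResolution _ _ fg_res fg_res_d (fg_cover_map M)).
- by move=> n; have [/dual_basis_projective] := fg_cover_mapP (fg_syzygy n).
- by have [_ ? _] := fg_cover_mapP M.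
- exact: (@fg_syzygy_im 0%N).
- exact: fg_res_exact.
Defined.

Lemma fg_resolution_dual_basis n : dual_basis (fg_resolution n).
Proof. by have [] := fg_cover_mapP (fg_syzygy n). Qed.

(** Comparison with a resolution of length [d] yields a homotopy [s], from which a linear section of
    the cover of the [d]-th syzygy is made; the syzygy is then a retract of a projective module. *)
Lemma fg_syzygy_projective d : projdim_le (fg_carrier M) d ->
  projective (fg_carrier (fg_syzygy d)).
Proof.
move=> [P Pd]; have [f [g [_ _ [s [_ sS]] _]]] := comparison fg_resolution P.
pose c := fg_cover_map (fg_syzygy d.+1).
have [_ csurj _] := fg_cover_mapP (fg_syzygy d.+1).
have [_ bsurj _] := fg_cover_mapP (fg_syzygy d).
(* In degree [d.+1] the comparison map factors through zero, so the homotopy relation reads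
   [- x = d (s x) + s (d x)], and [c] kills the first term. *)
have rE x : c x = - c (s d (fg_res_d d x)).
  have := sS d x; rewrite /= (Pd d.+1 (ltnSn d) (f d.+1 x)) linear0 sub0r.
  move/(congr1 c)/eqP; rewrite linearN linearD.
  have -> : c (fg_res_d d.+1 (s d.+1 x)) = 0 by apply/fg_syzygy_im; exists (s d.+1 x).
  by rewrite add0r eqr_oppLR => /eqP.
pose b x := sval (cid (bsurj x)).
have bE x : fg_cover_map (fg_syzygy d) (b x) = x := svalP (cid (bsurj x)).
(* The identity plus differential after homotopy. It vanishes on the kernel of the cover and does
   not change the image under the cover, so it induces the section. *)
pose q (x : fg_res d) : fg_res d := x + submod_val (c (s d x)).
have q0 x : fg_cover_map (fg_syzygy d) x = 0 -> q x = 0.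
  case/fg_syzygy_im => y <-; apply/eqP; rewrite /q addr_eq0.
  by apply/eqP; exact: (congr1 val (rE y)).
have qP a x y : q (a *: x + y) = a *: q x + q y.
  have cP : c (s d (a *: x + y)) = a *: c (s d x) + c (s d y) by rewrite 2!linearP.
  by rewrite /q cP /= scalerDr addrACA.
have qE x y : fg_cover_map (fg_syzygy d) x = fg_cover_map (fg_syzygy d) y -> q x = q y.
  move=> xy; have /q0 : fg_cover_map (fg_syzygy d) (-1 *: y + x) = 0.
    by rewrite linearP xy scaleN1r addNr.
  by rewrite qP scaleN1r addrC => /eqP; rewrite subr_eq0 => /eqP.
have [|h hE] := @linear_mapP _ (fg_carrier (fg_syzygy d)) (fg_res d) (q \o b).
  by move=> a x y; rewrite /= -qP; apply: qE; rewrite bE linearP !bE.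
apply: (@projective_retract _ _ (fg_res d) h (fg_cover_map (fg_syzygy d))).
  by move=> x; rewrite hE /= /q linearD bE cyclesP addr0.
exact: (@pres_proj _ _ fg_resolution d).
Qed.

Lemma fg_syzygy_zero n : projective (fg_carrier (fg_syzygy n)) ->
  is_zero (fg_carrier (fg_syzygy n.+1)).
Proof.
move=> nproj x; have [_ _ /(_ nproj) cinj] := fg_cover_mapP (fg_syzygy n).
by apply: val_inj; apply: cinj; rewrite linear0; exact: cyclesP.
Qed.

(** From degree [d] on all syzygies are projective, hence zero above [d], and the cover of a zero
    module is injective. *)
Lemma fg_resolution_zero d n : projdim_le (fg_carrier M) d -> (d < n)%N ->
  is_zero (fg_resolution n).
Proof.
move=> Md dn; have zproj N : is_zero (fg_carrier N) -> projective (fg_carrier N).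
  move=> N0 V W g f gsurj; exists \0 => x.
  by rewrite [x]N0 !linear0.
have: is_zero (fg_carrier (fg_syzygy n)).
  case: n dn => // n; rewrite ltnS => dn; apply: fg_syzygy_zero.
  elim: n dn => [|n IH].
    by rewrite leqn0 => /eqP d0; have := fg_syzygy_projective Md; rewrite d0.
  rewrite leq_eqVlt => /orP[/eqP<-|/IH nproj]; first exact: fg_syzygy_projective.
  by apply: zproj; exact: fg_syzygy_zero.
move=> n0 x; have [_ _ cinj] := fg_cover_mapP (fg_syzygy n).
by apply: (cinj (zproj _ n0)); rewrite [LHS]n0 [RHS]n0.
Qed.

End FiniteResolution.

(** * Exactness of tensor products of vector spaces *)

Section VectorSpaces.
Variable k : fieldType.

(** By Zorn's lemma there is a maximal subspace [X] meeting [U] trivially; a vector outside [U + X]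
    could be added to it. *)
Lemma subspace_projection (V : lmodType k) (U : submodule V) :
  exists p : {linear V -> V}, (forall x, U (p x)) /\ forall x, U x -> p x = x.
Proof.
pose avoids (X : set V) := (forall a x y, X x -> X y -> X (a *: x + y)) /\
  forall x, X x -> U x -> x = 0.
have [F Favoids Ftot|X [[XP XU] Xmax]] := @Zorn_bigcup V avoids.
  split=> [a x y [Y FY Yx] [Z FZ Zy]|x [Y FY Yx]]; last exact: (Favoids _ FY).2.
  have [YZ|ZY] := Ftot _ _ FY FZ.
    by exists Z => //; apply: (Favoids _ FZ).1 => //; exact: YZ.
  by exists Y => //; apply: (Favoids _ FY).1 => //; exact: ZY.
(* A maximal [X] may be empty, hence [X0]. *)
pose X0 x := X x \/ x = 0.
have X0P a x y : X0 x -> X0 y -> X0 (a *: x + y).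
  move=> [Xx|->] [Xy|->]; rewrite ?scaler0 ?addr0 ?add0r; [left..|by right].
  - exact: XP.
  - have X00 : X 0 by have := XP (-1) _ _ Xx Xx; rewrite scaleN1r addNr.
    by rewrite -[_ *: _]addr0; exact: XP.
  - exact: Xy.
have X0U x : X0 x -> U x -> x = 0 by case=> [|->//]; exact: XU.
have UZ a x : U x -> U (a *: x).
  by move=> Ux; rewrite -[_ *: _]addr0; apply: submodP => //; exact: submod0.
have UD x y : U x -> U y -> U (x + y).
  by move=> Ux Uy; rewrite -[x]scale1r; exact: submodP.
have X0Z a x : X0 x -> X0 (a *: x).
  by move=> Xx; rewrite -[_ *: _]addr0; apply: X0P => //; right.
have dec x : exists u, U u /\ X0 (x - u).
  apply: contrapT => nx; pose B : set V := fun y => exists a w, X0 w /\ y = a *: x + w.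
  have Xx : ~ X x by move=> Xx; apply: nx; exists 0; split; [exact: submod0|rewrite subr0; left].
  apply: (Xmax B).
    split=> [y Xy|BX]; first by exists 0, y; split; [left|rewrite scale0r add0r].
    by apply/Xx/BX; exists 1, 0; split; [right|rewrite scale1r addr0].
  split=> [a _ _ [b [w [Xw ->]]] [c [z [Xz ->]]]|_ [b [w [Xw ->]]] Ub].
    exists (a * b + c), (a *: w + z); split; first exact: X0P.
    by rewrite scalerDr scalerDl scalerA addrACA.
  have [b0|b0] := eqVneq b 0.
    by move: Ub; rewrite b0 scale0r add0r; exact: X0U.
  case: nx; exists (b^-1 *: (b *: x + w)); split; first exact: UZ.
  by rewrite scalerDr scalerA mulVf // scale1r opprD addNKr -scaleN1r scalerA; exact: X0Z.
pose p x := sval (cid (dec x)).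
have pP x : U (p x) /\ X0 (x - p x) := svalP (cid (dec x)).
have puniq x u : U u -> X0 (x - u) -> p x = u.
  move=> Uu Xu; have [Up Xp] := pP x; apply/eqP; rewrite -subr_eq0; apply/eqP/X0U.
    have := X0P (-1) _ _ Xp Xu.
    by rewrite scaleN1r opprB addrA subrK.
  by rewrite addrC -scaleN1r; exact: submodP.
have [|q qE] := @linear_mapP _ V V p.
  move=> a x y; have [Ux Xx] := pP x; have [Uy Xy] := pP y.
  apply: puniq; first exact: submodP.
  have := X0P a _ _ Xx Xy; congr X0.
  by rewrite scalerBr opprD addrACA.
exists q; split=> [x|x Ux]; rewrite qE; first exact: (pP x).1.
by apply: puniq => //; rewrite subrr; right.
Qed.

Lemma generalized_inverse (V W : lmodType k) (g : {linear V -> W}) :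
  exists h : {linear W -> V}, forall x, g (h (g x)) = g x.
Proof.
have im0 : exists x, g x = 0 by exists 0; rewrite linear0.
have imP a u v : (exists y, g y = u) -> (exists y, g y = v) -> exists y, g y = a *: u + v.
  by move=> [y <-] [z <-]; exists (a *: y + z); rewrite linearP.
have [p [pI pE]] := subspace_projection (Submodule im0 imP).
have [q [qK qE]] := subspace_projection (kernel g).
(* Subtracting the projection to the kernel removes the dependence on the chosen preimage, whence
   linearity. *)
pose h w := let v := sval (cid (pI w)) in v - q v.
have hE w v : g v = p w -> h w = v - q v.
  rewrite /h; case: cid => u /= uE vE.
  have /qE : g (u - v) = 0 by rewrite linearB uE vE subrr.
  rewrite linearB => quv; apply/eqP; rewrite -subr_eq0 opprD addrACA -opprD quv.
  by rewrite subrr.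
have [|h' h'E] := @linear_mapP _ W V h.
  move=> a x y; have [[u uE] [v vE]] := (pI x, pI y).
  have uvE : g (a *: u + v) = p (a *: x + y) by rewrite !linearP uE vE.
  by rewrite (hE _ _ uE) (hE _ _ vE) (hE _ _ uvE) linearP scalerBr opprD addrACA.
exists h' => x; have xE : g x = p (g x) by rewrite pE //; exists x.
by rewrite h'E (hE _ _ xE) linearB [g (q x)]qK subr0.
Qed.

(** Over a field exactness becomes an identity between linear maps, and such an identity survives
    tensoring with any space. *)
Lemma exact_contraction (U V W : lmodType k) (f : {linear U -> V}) (g : {linear V -> W}) :
  (forall x, g x = 0 -> exists y, f y = x) ->
  exists (s : {linear V -> U}) (h : {linear W -> V}), forall x, f (s x) + h (g x) = x.
Proof.
move=> fg; have [s sE] := generalized_inverse f; have [h hE] := generalized_inverse g.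
have [|t tE] := @linear_mapP _ V U (fun x => s (x - h (g x))).
  move=> a x y; rewrite -linearP; congr (s _).
  by rewrite (linearP g) (linearP h) scalerBr opprD addrACA.
exists t, h => x; rewrite tE.
have [|y yE] := fg (x - h (g x)); first by rewrite linearB hE subrr.
by rewrite -yE sE yE subrK.
Qed.

Section TensorElements.
Variables (V W : lmodType k).

Lemma tensDl (v v' : V) (w : W) : tens (v + v') w = tens v w + tens v' w.
Proof. by have := tensPl w 1 v v'; rewrite !scale1r. Qed.

Lemma tensDr (v : V) (w w' : W) : tens v (w + w') = tens v w + tens v w'.
Proof. by have := tensPr v 1 w w'; rewrite !scale1r. Qed.

Lemma tens0l (w : W) : tens (0 : V) w = 0.
Proof. by apply: (addrI (tens 0 w)); rewrite -tensDl !addr0. Qed.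

Lemma tens0r (v : V) : tens v (0 : W) = 0.
Proof. by apply: (addrI (tens v 0)); rewrite -tensDr !addr0. Qed.

Lemma tensZl a (v : V) (w : W) : tens (a *: v) w = a *: tens v w.
Proof. by have := tensPl w a v 0; rewrite tens0l !addr0. Qed.

Lemma tensZr a (v : V) (w : W) : tens v (a *: w) = a *: tens v w.
Proof. by have := tensPr v a w 0; rewrite tens0r !addr0. Qed.
End TensorElements.

Lemma tmap0 (V W V' W' : lmodType k) (f : {linear V -> V'}) (g : {linear W -> W'}) :
  tmap f g 0 = 0.
Proof. exact: (@lmod_map0 k (tensor V W) (tensor V' W') (tmap f g)). Qed.

Lemma tmapP (V W V' W' : lmodType k) (f : {linear V -> V'}) (g : {linear W -> W'}) a x y :
  tmap f g (a *: x + y) = a *: tmap f g x + tmap f g y.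
Proof. exact: (tlift_linear (tmap_bilinear f g)). Qed.

Lemma tmap_exact (U V W Y : lmodType k) (f : {linear U -> V}) (g : {linear V -> W}) :
  (forall x, g x = 0 <-> exists y, f y = x) ->
  forall t : tensor V Y, tmap g idfun t = 0 <-> exists u : tensor U Y, tmap f idfun u = t.
Proof.
move=> fg t; split=> [gt|[u <-]].
  have [s [h shE]] := exact_contraction (fun x => (fg x).1).
  exists (tmap s idfun t).
  have tE : tmap f idfun (tmap s idfun t) + tmap h idfun (tmap g idfun t) = t.
    elim/tensor_ind: t {gt} => [|a v y t IH]; first by rewrite !tmap0 addr0.
    by rewrite !tmapP addrACA IH -scalerDr !tmapE -tensDl shE.
  by rewrite -[RHS]tE gt tmap0 addr0.
elim/tensor_ind: u => [|a x y u IH]; first by rewrite !tmap0.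
rewrite !tmapP IH !tmapE.
have -> : g (f x) = 0 by apply/fg; exists x.
by rewrite tens0l scaler0 addr0.
Qed.

End VectorSpaces.

(** * Outer tensor products as modules over a tensor product of algebras *)

Section OuterTensor.
Variables (k : fieldType) (B C : algType k).

Section LeftScaling.
Variables (R : algType k) (V : lmodType R).

Lemma kspaceE (a : k) (v : kspace V) : a *: v = (a%:A : R) *: (v : V).
Proof. by []. Qed.

Definition lscale (r : R) (v : kspace V) : kspace V := r *: (v : V).

Fact lscale_linear r : linear (lscale r).
Proof.
move=> a u v; rewrite /lscale !kspaceE scalerDr !scalerA.
by rewrite mulr_algr mulr_algl.
Qed.
HB.instance Definition _ r :=
  GRing.isLinear.Build k (kspace V) (kspace V) *:%R (lscale r) (lscale_linear r).

Lemma lscaleP a r s v : lscale (a *: r + s) v = a *: lscale r v + lscale s v.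
Proof. by rewrite /lscale kspaceE scalerDl scalerA mulr_algl. Qed.
End LeftScaling.

Variables (V : lmodType B) (W : lmodType C).

Definition outer : Type := tensor (kspace V) (kspace W).
HB.instance Definition _ := GRing.Zmodule.on outer.

Fact outer_bilinear (x : tensor (kspace V) (kspace W)) :
  bilinear_for *:%R *:%R (fun (b : B) (c : C) => tmap (@lscale B V b) (@lscale C W c) x).
Proof.
split=> [c|b] a u v /=; elim/tensor_ind: x => [|d y z x IH].
- by rewrite !tmap0 scaler0 addr0.
- rewrite !tmapP IH !tmapE /= lscaleP tensPl !scalerDr addrACA !scalerA [a * d]mulrC.
  by [].
- by rewrite !tmap0 scaler0 addr0.
rewrite !tmapP IH !tmapE /= lscaleP tensPr !scalerDr addrACA !scalerA [a * d]mulrC.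
by [].
Qed.
Definition outer_act (t : tensor B C) (x : outer) : outer := tlift (outer_bilinear x) t.

Lemma outer_actE b c x : outer_act (tens b c) x = tmap (@lscale B V b) (@lscale C W c) x.
Proof. exact: tliftE. Qed.

Lemma outer_actPl a s t x :
  outer_act (a *: s + t) x = a *: (outer_act s x : tensor _ _) + outer_act t x
    :> tensor (kspace V) (kspace W).
Proof. exact: (linearP (tlift (outer_bilinear x))). Qed.

Lemma outer_act0l x : outer_act 0 x = 0.
Proof. exact: (linear0 (tlift (outer_bilinear x))). Qed.

Lemma outer_actPr t a x y :
  outer_act t (a *: (x : tensor _ _) + y) =
  a *: (outer_act t x : tensor _ _) + outer_act t y :> tensor (kspace V) (kspace W).
Proof.
elim/tensor_ind: t => [|c b d t IH]; first by rewrite !outer_act0l scaler0 addr0.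
rewrite !outer_actPl IH !outer_actE tmapP !scalerDr addrACA !scalerA [a * c]mulrC.
by [].
Qed.

Fact outer_actDr : right_distributive outer_act +%R.
Proof. by move=> t x y; have := outer_actPr t 1 x y; rewrite !scale1r. Qed.

Lemma outer_act0r t : outer_act t 0 = 0.
Proof. by apply: (addrI (outer_act t 0)); rewrite -outer_actDr !addr0. Qed.

Fact outer_actA s t x : outer_act s (outer_act t x) = outer_act (s * t) x.
Proof.
elim/tensor_ind: s => [|a b c s IH]; first by rewrite mul0r !outer_act0l.
rewrite mulrDl -scalerAl !outer_actPl IH; congr (_ *: _ + _) => {a s IH}.
elim/tensor_ind: t => [|a b' c' t IH]; first by rewrite mulr0 !outer_act0l outer_act0r.
rewrite mulrDr -scalerAr !outer_actPl -IH outer_actPr; congr (_ *: _ + _) => {a t IH}.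
rewrite tensM !outer_actE.
elim/tensor_ind: x => [|a v w x IH]; first by rewrite !tmap0.
by rewrite !tmapP IH !tmapE /= /lscale !scalerA.
Qed.

Fact outer_act1 : left_id 1 outer_act.
Proof.
move=> x; rewrite tens1 outer_actE; elim/tensor_ind: x => [|a v w x IH]; first by rewrite tmap0.
by rewrite tmapP IH tmapE /= /lscale !scale1r.
Qed.

Fact outer_actDl x : {morph outer_act^~ x : s t / s + t}.
Proof. by move=> s t; have := outer_actPl 1 s t x; rewrite !scale1r. Qed.

HB.instance Definition _ := GRing.Zmodule_isLmodule.Build (tensor B C) outer
  outer_actA outer_act1 outer_actDr outer_actDl.

End OuterTensor.

Section OuterMap.
Variables (k : fieldType) (B C : algType k) (V V' : lmodType B) (W : lmodType C).
Variable f : {linear V -> V'}.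

Let f1 : {linear kspace V -> kspace V'} := restr_map _ f.

Definition outer_map (x : outer V W) : outer V' W := tmap f1 idfun x.

Fact outer_map_linear : linear outer_map.
Proof.
move=> t x y; rewrite /outer_map.
have D u v : tmap f1 idfun (u + v) = tmap f1 idfun u + tmap f1 idfun v
    :> tensor (kspace V') (kspace W).
  by have := tmapP f1 idfun 1 u v; rewrite !scale1r.
rewrite [LHS]D; congr (_ + _); rewrite -![_ *: _]/(outer_act _ _).
have E b c u : tmap f1 idfun (outer_act (tens b c) u) = outer_act (tens b c) (tmap f1 idfun u).
  rewrite !outer_actE; elim/tensor_ind: u => [|a v w u IH]; first by rewrite !tmap0.
  by rewrite !tmapP IH !tmapE /= /lscale /restr_map linearZ.
elim/tensor_ind: t => [|a b c t IH]; first by rewrite !outer_act0l tmap0.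
by rewrite !outer_actPl tmapP IH E.
Qed.
HB.instance Definition _ := GRing.isLinear.Build (tensor B C) (outer V W) (outer V' W)
  *:%R outer_map outer_map_linear.
End OuterMap.

(** * The Galois map of a Hopf algebra *)

Section TensorAssocAlgebra.
Variables (k : fieldType) (A B C : algType k).

Lemma tassoc0 : @tassoc k A B C 0 = 0.
Proof. exact: (@lmod_map0 k (tensor (tensor A B) C) (tensor A (tensor B C)) (@tassoc k A B C)). Qed.

Lemma tassocP a x y : @tassoc k A B C (a *: x + y) = a *: tassoc x + tassoc y.
Proof. exact: (@lmod_mapP k (tensor (tensor A B) C) (tensor A (tensor B C)) (@tassoc k A B C)). Qed.

Lemma tassoc_tensPl a s t c :
  @tassoc k A B C (tens (a *: s + t) c) = a *: tassoc (tens s c) + tassoc (tens t c).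
Proof. by rewrite tensPl tassocP. Qed.

Lemma tassoc_tmul s t : @tassoc k A B C (tmul s t) = tmul (tassoc s) (tassoc t).
Proof.
elim/tensor_ind: s => [|d u c s IHs]; first by rewrite tmul0l tassoc0 tmul0l.
rewrite tmulPl !tassocP IHs tmulPl; congr (_ *: _ + _) => {d s IHs}.
elim/tensor_ind: t => [|d v c' t IHt]; first by rewrite tmul0r tassoc0 tmul0r.
rewrite tmulPr !tassocP IHt tmulPr; congr (_ *: _ + _) => {d t IHt}.
rewrite tmulE -[u * v]/(tmul u v).
elim/tensor_ind: u => [|d a b u IHu]; first by rewrite tmul0l !tens0l tassoc0 tmul0l.
rewrite tmulPl !tassoc_tensPl IHu tmulPl; congr (_ *: _ + _) => {d u IHu}.
elim/tensor_ind: v => [|d a' b' v IHv]; first by rewrite tmul0r !tens0l tassoc0 tmul0r.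
rewrite tmulPr !tassoc_tensPl IHv tmulPr; congr (_ *: _ + _) => {d v IHv}.
by rewrite tmulE !tassocE tmulE tensM.
Qed.

(** Needed for [env_comul] to be a ring morphism, along which modules can be restricted. *)
Fact tassoc_monoid_morphism : monoid_morphism (@tassoc k A B C).
Proof. by split=> [|s t]; [exact: tassocE|exact: tassoc_tmul]. Qed.
HB.instance Definition _ := GRing.isMonoidMorphism.Build (tensor (tensor A B) C)
  (tensor A (tensor B C)) (@tassoc k A B C) tassoc_monoid_morphism.
End TensorAssocAlgebra.

Section Sweedler.
Variables (k : fieldType) (A : algType k) (H : hopf_structure A).

(* [x_1 (x) f x_2 y], where [u] stands for the coproduct of [x]. *)
Definition sweedler (f : {linear A -> A}) (u : tensor A A) (y : A) : tensor A A :=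
  tmap idfun (tlift (convl_bilinear f)) (tassoc (tens u y)).

Lemma sweedlerE f a b y : sweedler f (tens a b) y = tens a (f b * y).
Proof. by rewrite /sweedler tassocE tmapE /= tliftE. Qed.

Lemma sweedlerPl f c u v y : sweedler f (c *: u + v) y = c *: sweedler f u y + sweedler f v y.
Proof. by rewrite /sweedler tassoc_tensPl tmapP. Qed.

Lemma sweedler0l f y : sweedler f 0 y = 0.
Proof. by rewrite /sweedler tens0l tassoc0 tmap0. Qed.

Lemma sweedlerM f u y z : sweedler f u (y * z) = tmul (sweedler f u y) (tens 1 z).
Proof.
elim/tensor_ind: u => [|c a b u IH]; first by rewrite !sweedler0l tmul0l.
by rewrite !sweedlerPl IH tmulPl !sweedlerE tmulE mulr1 mulrA.
Qed.

Definition galois (f : {linear A -> A}) (t : tensor A A) : tensor A A :=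
  tmap idfun (tlift (convl_bilinear f)) (tassoc (tmap (comul H) idfun t)).

Lemma galoisE f x y : galois f (tens x y) = sweedler f (comul H x) y.
Proof. by rewrite /galois tmapE. Qed.

Lemma galoisP f c s t : galois f (c *: s + t) = c *: galois f s + galois f t.
Proof. by rewrite /galois tmapP tassocP tmapP. Qed.

Lemma galois0 f : galois f 0 = 0.
Proof. by rewrite /galois !tmap0 tassoc0 tmap0. Qed.

(** Linearity over the right factor reduces the two inversion formulas to elements [x (x) 1]. *)
Lemma galoisM f t z : galois f (tmul t (tens 1 z)) = tmul (galois f t) (tens 1 z).
Proof.
elim/tensor_ind: t => [|c x y t IH]; first by rewrite tmul0l !galois0 tmul0l.
by rewrite tmulPl !galoisP IH tmulPl tmulE mulr1 !galoisE sweedlerM.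
Qed.

(** By coassociativity the left side is [x_1 (x) S(x_2) x_3], and the antipode and counit laws
    collapse it. *)
Lemma galois_antipode_comul x :
  galois (antipode H) (comul H x) = tens x 1.
Proof.
rewrite /galois comulA.
have E u : tmap idfun (tlift (convl_bilinear (antipode H))) (tmap idfun (comul H) u) =
    tens (tlift (counitr_bilinear (counit H)) u) 1.
  elim/tensor_ind: u => [|c a b u IH]; first by rewrite !tmap0 (lmod_map0 (tlift _)) tens0l.
  rewrite !tmapP IH (lmod_mapP (tlift _)) tensPl !tmapE /= antipodel tliftE; congr (_ *: _ + _).
  by rewrite tensZl -tensZr.
by rewrite E counitr.
Qed.

(** The mirror computation, with [x_1 (x) x_2 S(x_3)]. *)
Lemma galois_id_antipode x : galois idfun (tmap idfun (antipode H) (comul H x)) = tens x 1.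
Proof.
have G b (v : tensor A A) : sweedler idfun v (antipode H b) =
    tmap idfun (tlift (convr_bilinear (antipode H))) (tassoc (tens v b)).
  elim/tensor_ind: v => [|c p q v IH]; first by rewrite sweedler0l tens0l tassoc0 tmap0.
  by rewrite sweedlerPl IH tassoc_tensPl tmapP sweedlerE tassocE tmapE /= tliftE.
have E u : galois idfun (tmap idfun (antipode H) u) =
    tmap idfun (tlift (convr_bilinear (antipode H))) (tassoc (tmap (comul H) idfun u)).
  elim/tensor_ind: u => [|c a b u IH]; first by rewrite !tmap0 galois0 tassoc0 tmap0.
  rewrite !tmapP tassocP galoisP IH tmapP !tmapE galoisE; congr (_ *: _ + _) => {c u IH}.
  exact: G.
rewrite E comulA.
have F u : tmap idfun (tlift (convr_bilinear (antipode H))) (tmap idfun (comul H) u) =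
    tens (tlift (counitr_bilinear (counit H)) u) 1.
  elim/tensor_ind: u => [|c a b u IH]; first by rewrite !tmap0 (lmod_map0 (tlift _)) tens0l.
  rewrite !tmapP IH (lmod_mapP (tlift _)) tensPl !tmapE /= antipoder tliftE; congr (_ *: _ + _).
  by rewrite tensZl -tensZr.
by rewrite F counitr.
Qed.

Lemma galois_id1 x : galois idfun (tens x 1) = comul H x.
Proof.
rewrite galoisE; elim/tensor_ind: (comul H x) => [|c a b u IH]; first exact: sweedler0l.
by rewrite sweedlerPl IH sweedlerE mulr1.
Qed.

Lemma galois_antipode1 x : galois (antipode H) (tens x 1) = tmap idfun (antipode H) (comul H x).
Proof.
rewrite galoisE; elim/tensor_ind: (comul H x) => [|c a b u IH]; first by rewrite sweedler0l tmap0.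
by rewrite sweedlerPl IH sweedlerE mulr1 tmapP tmapE.
Qed.

Lemma tens_tmul1 (x y : A) : tens x y = tmul (tens x 1) (tens 1 y).
Proof. by rewrite tmulE mulr1 mul1r. Qed.

Lemma galoisK : cancel (galois idfun) (galois (antipode H)).
Proof.
move=> t; elim/tensor_ind: t => [|c x y t IH]; first by rewrite !galois0.
by rewrite !galoisP IH tens_tmul1 !galoisM galois_id1 galois_antipode_comul.
Qed.

Lemma galoisVK : cancel (galois (antipode H)) (galois idfun).
Proof.
move=> t; elim/tensor_ind: t => [|c x y t IH]; first by rewrite !galois0.
by rewrite !galoisP IH tens_tmul1 !galoisM galois_antipode1 galois_id_antipode.
Qed.

End Sweedler.

Section HopfBimodule.
Variables (k : fieldType) (A : algType k) (H : hopf_structure A).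

Definition env_comul : env A -> tensor A (env A) :=
  @tassoc k A A A^c \o tmap (comul H) idfun.
HB.instance Definition _ := GRing.RMorphism.copy env_comul
  (@tassoc k A A A^c \o tmap (comul H) idfun : {rmorphism env A -> tensor A (env A)}).

(* The [A]-bimodule [Q (x) A], with [a (q (x) y) b = a_1 q (x) a_2 y b]. *)
Definition hopf_bimod (Q : lmodType A) : lmodType (env A) :=
  restr env_comul (outer Q (regl A)).

Definition hopf_map (Q Q' : lmodType A) (f : {linear Q -> Q'}) :
    {linear hopf_bimod Q -> hopf_bimod Q'} :=
  restr_map env_comul (outer_map f : {linear outer Q (regl A) -> outer Q' (regl A)}).

Definition hopf_tens (Q : lmodType A) (q : Q) (y : A) : hopf_bimod Q :=
  tens (q : kspace Q) ((y : regl A) : kspace (regl A)).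
End HopfBimodule.

(** * Bimodules induced from modules *)

Section HopfBimoduleTheory.
Variables (k : fieldType) (A : algType k) (H : hopf_structure A).

(** [kspace] lets [c] act through [c%:A]; agreement with the given scaling is an equation, not a
    conversion. *)
Lemma kspace_regularE c (a : kspace A^o) : c *: a = c *: (a : A) :> A.
Proof. exact: mulr_algl. Qed.

Lemma kspace_reglE c (y : kspace (regl A)) : c *: y = c *: (y : A) :> A.
Proof.
have E := @regl_actPl k A c (tens 1 1) 0 y.
rewrite addr0 regl_act0 addr0 regl_actE mul1r mulr1 in E; exact: E.
Qed.

Lemma env_comulE a b : env_comul H (tens a b) = tassoc (tens (comul H a) b).
Proof. by rewrite -[LHS]/(tassoc (tmap (comul H) idfun (tens a b))) tmapE. Qed.

Lemma env_comulP c s t : env_comul H (c *: s + t) = c *: env_comul H s + env_comul H t.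
Proof.
by rewrite -[LHS]/(tassoc (tmap (comul H) idfun (c *: s + t))) tmapP tassocP.
Qed.

Lemma env_comul0 : env_comul H 0 = 0.
Proof. by rewrite -[LHS]/(tassoc (tmap (comul H) idfun 0)) tmap0 tassoc0. Qed.

Lemma hopf_tens_ind (Q : lmodType A) (X : hopf_bimod H Q -> Prop) : X 0 ->
  (forall q y t, X t -> X (hopf_tens H q y + t)) -> forall t, X t.
Proof.
move=> X0 XD t; elim/tensor_ind: t => [//|c q y t IH].
rewrite -tensZr; exact: (XD q (c *: y) t IH).
Qed.

Lemma hopf_mapE (Q Q' : lmodType A) (f : {linear Q -> Q'}) q y :
  hopf_map H f (hopf_tens H q y) = hopf_tens H (f q) y.
Proof. exact: tmapE. Qed.

Lemma hopf_tensDl (Q : lmodType A) (q q' : Q) y :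
  hopf_tens H (q + q') y = hopf_tens H q y + hopf_tens H q' y.
Proof. exact: (@tensDl k (kspace Q) (kspace (regl A))). Qed.

Lemma hopf_tensDr (Q : lmodType A) (q : Q) y y' :
  hopf_tens H q (y + y') = hopf_tens H q y + hopf_tens H q y'.
Proof. exact: (@tensDr k (kspace Q) (kspace (regl A))). Qed.

Lemma hopf_tensZ (Q : lmodType A) c (q : Q) y :
  hopf_tens H q (c *: y) = hopf_tens H (c *: (q : kspace Q)) y.
Proof.
rewrite -(kspace_reglE c y) /hopf_tens.
exact: etrans (tensZr c (q : kspace Q) (y : kspace (regl A))) (esym (tensZl _ _ _)).
Qed.

Lemma outer_act_hopf_tens (Q : lmodType A) a a' (b : A^c) (q : Q) y :
  outer_act (tassoc (tens (tens a a') b)) (hopf_tens H q y : outer Q (regl A)) =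
  hopf_tens H (a *: q) (a' * y * (b : A)).
Proof. by rewrite tassocE outer_actE tmapE /= /lscale [X in tens _ X]regl_actE. Qed.

Lemma additive_homogeneous_linear (V W : lmodType k) (f : V -> W) :
  (forall x y, f (x + y) = f x + f y) -> (forall c x, f (c *: x) = c *: f x) ->
  exists g : {linear V -> W}, g =1 f.
Proof. by move=> fD fZ; apply: linear_mapP => c x y; rewrite fD fZ. Qed.

(** The orbit map of [1 (x) 1], visibly linear; on [x (x) y] it is [x_1 (x) x_2 y], the Galois
    map. *)
Definition hopf_free_map (t : (env A)^o) : hopf_bimod H A^o :=
  (t : env A) *: hopf_tens H (1 : A^o) 1.

Fact hopf_free_map_linear : linear hopf_free_map.
Proof. by move=> a x y; rewrite /hopf_free_map scalerDl scalerA. Qed.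
HB.instance Definition _ := GRing.isLinear.Build (env A) (env A)^o (hopf_bimod H A^o)
  *:%R hopf_free_map hopf_free_map_linear.

Lemma hopf_free_map_bijective : bijective hopf_free_map.
Proof.
(* These six maps are all the identity of [A], linear between its various scalings; [L], [L'], [E]
   and [E'] below only relabel tensors through them. *)
have [||iA iAE] := @additive_homogeneous_linear A (kspace A^o) id;
  [by []|by move=> c x; rewrite kspace_regularE|].
have [||jA jAE] := @additive_homogeneous_linear (kspace A^o) A id;
  [by []|by move=> c x; rewrite kspace_regularE|].
have [||iR iRE] := @additive_homogeneous_linear A (kspace (regl A)) id;
  [by []|by move=> c x; rewrite kspace_reglE|].
have [||jR jRE] := @additive_homogeneous_linear (kspace (regl A)) A id;
  [by []|by move=> c x; rewrite kspace_reglE|].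
have [||iC iCE] := @additive_homogeneous_linear A A^c id; [by []|by []|].
have [||jC jCE] := @additive_homogeneous_linear A^c A id; [by []|by []|].
pose L (t : tensor A A) : tensor (kspace A^o) (kspace (regl A)) := tmap iA iR t.
pose L' (t : tensor (kspace A^o) (kspace (regl A))) : tensor A A := tmap jA jR t.
pose E (t : env A) : tensor A A := tmap idfun jC t.
pose E' (t : tensor A A) : env A := tmap idfun iC t.
have LK : cancel L L'.
  elim/tensor_ind=> [|c x y t IH]; first by rewrite /L' /L !tmap0.
  by rewrite /L' /L !tmapP !tmapE iAE iRE jAE jRE [tmap _ _ _]IH.
have LVK : cancel L' L.
  elim/tensor_ind=> [|c x y t IH]; first by rewrite /L' /L !tmap0.
  by rewrite /L' /L !tmapP !tmapE jAE jRE iAE iRE [tmap _ _ _]IH.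
have EK : cancel E E'.
  elim/tensor_ind=> [|c x y t IH]; first by rewrite /E' /E !tmap0.
  by rewrite /E' /E !tmapP !tmapE jCE iCE [tmap _ _ _]IH.
have EVK : cancel E' E.
  elim/tensor_ind=> [|c x y t IH]; first by rewrite /E' /E !tmap0.
  by rewrite /E' /E !tmapP !tmapE iCE jCE [tmap _ _ _]IH.
have act (u : tensor A A) y : outer_act (tassoc (tens u (y : A^c)))
    (hopf_tens H (1 : A^o) 1 : outer A^o (regl A)) = L (sweedler idfun u y).
  elim/tensor_ind: u => [|c a b u IH].
    by rewrite tens0l tassoc0 outer_act0l sweedler0l /L tmap0.
  rewrite tassoc_tensPl outer_actPl outer_act_hopf_tens IH sweedlerPl sweedlerE /L tmapP tmapE.
  by have -> : a *: (1 : A^o) = a by [exact: mulr1]; rewrite iAE iRE mulr1.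
have LP c s t : L (c *: s + t) = c *: L s + L t by exact: tmapP.
have EP c s t : E (c *: s + t) = c *: E s + E t by exact: tmapP.
have HE x y : outer_act (env_comul H (tens x y)) (hopf_tens H (1 : A^o) 1) =
    L (galois H idfun (E (tens x y))).
  by rewrite env_comulE act /E tmapE galoisE jCE.
have JE t : hopf_free_map t = L (galois H idfun (E t)).
  elim/tensor_ind: t => [|c x y t IH].
    by rewrite /E tmap0 galois0 /L tmap0 /hopf_free_map scale0r.
  rewrite -[LHS]/(outer_act (env_comul H (c *: tens x y + t)) (hopf_tens H (1 : A^o) 1)).
  by rewrite env_comulP outer_actPl HE -[X in _ + X = _]/(hopf_free_map t) IH EP galoisP LP.
by exists (fun t => E' (galois H (antipode H) (L' t))) => t;
  rewrite JE ?LK ?galoisK ?EK // EVK galoisVK LVK.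
Qed.

(** The basis elements are [p_i (x) 1]; the forms are [f_i (x) id] followed by the identification of
    [A (x) A] with [A^e]. *)
Lemma hopf_bimod_dual_basis (Q : lmodType A) : dual_basis Q -> dual_basis (hopf_bimod H Q).
Proof.
move=> [n [p [f pf]]].
have [g [gK Kg]] := inverse_linear (f := hopf_free_map) hopf_free_map_bijective.
exists n, (fun i => hopf_tens H (p i) 1), (fun i => g \o hopf_map H (f i)).
have [r rE] : exists r : 'I_n -> {linear A^o -> Q}, forall i a, r i a = (a : A) *: p i.
  have rP i : linear (fun a : A^o => (a : A) *: p i).
    by move=> a x y; rewrite scalerDl scalerA.
  by exists (fun i => sval (cid (linear_mapP (rP i)))) => i a;
    rewrite (svalP (cid (linear_mapP (rP i)))).
(* Both sides come from linear maps on a module generated by [1 (x) 1], which [r i] sends to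
   [p_i (x) 1]. *)
have E i t : (g (hopf_map H (f i) t) : env A) *: hopf_tens H (p i) 1 =
    hopf_map H (r i) (hopf_map H (f i) t).
  rewrite -[in RHS](Kg (hopf_map H (f i) t)) /hopf_free_map.
  rewrite (linearZ_LR (hopf_map H (r i))) hopf_mapE rE scale1r.
  by [].
move=> t; under [RHS]eq_bigr => i _ do rewrite [X in X *: _]/= E.
elim/hopf_tens_ind: t => [|q y t IH].
  rewrite big1 // => i _; rewrite (lmod_map0 (hopf_map H (f i))).
  exact: (lmod_map0 (hopf_map H (r i))).
rewrite [in LHS]IH [in LHS](pf q).
have -> : hopf_tens H (\sum_i (f i q : A) *: p i) y =
    \sum_i hopf_map H (r i) (hopf_map H (f i) (hopf_tens H q y)).
  rewrite (big_morph (fun q => hopf_tens H q y) (fun a b => hopf_tensDl a b y) (id1 := 0)).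
    by apply: eq_bigr => i _; rewrite !hopf_mapE rE.
  exact: tens0l.
rewrite -big_split; apply: eq_bigr => i _ /=.
rewrite (lmod_mapD (hopf_map H (f i))).
exact/esym/(lmod_mapD (hopf_map H (r i))).
Qed.
End HopfBimoduleTheory.

(** * The resolution of the regular bimodule *)

Section HopfResolution.
Variables (k : fieldType) (A : algType k) (H : hopf_structure A).

Definition trivial_module : lmodType A := restr (char_left (counit H)) k^o.

Lemma trivial_scaleE (a : A) (c : trivial_module) : a *: c = (counit H a : k) * (c : k) :> k.
Proof. by []. Qed.

Lemma counit_scalar c : counit H c%:A = c.
Proof. by rewrite linearZ /= rmorph1; exact: mulr1. Qed.

Fact trivial_tens_bilinear : bilinear_for *:%R *:%R
  (fun (c : kspace trivial_module) (y : kspace (regl A)) => ((c : k) *: (y : A) : A)).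
Proof.
split=> [y|c] a u v /=.
  rewrite scalerDl; congr (_ + _).
  by rewrite kspaceE trivial_scaleE counit_scalar scalerA.
by rewrite scalerDr kspace_reglE !scalerA mulrC.
Qed.

Definition trivial_mul : tensor (kspace trivial_module) (kspace (regl A)) -> A :=
  tlift trivial_tens_bilinear.

Lemma trivial_mulE c y : trivial_mul (hopf_tens H c y) = (c : k) *: y.
Proof. exact: tliftE. Qed.

Lemma trivial_mulP a s t : trivial_mul (a *: s + t) = a *: trivial_mul s + trivial_mul t.
Proof. exact: (tlift_linear trivial_tens_bilinear). Qed.

Lemma trivial_mul0 : trivial_mul 0 = 0.
Proof. exact: (lmod_map0 (tlift trivial_tens_bilinear)). Qed.

Lemma trivial_mulD s t : trivial_mul (s + t) = trivial_mul s + trivial_mul t.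
Proof. by have := trivial_mulP 1 s t; rewrite !scale1r. Qed.

Let counit_mul : tensor A A -> A := tlift (counitl_bilinear (counit H)).

Let counit_mulP a s t : counit_mul (a *: s + t) = a *: counit_mul s + counit_mul t.
Proof. exact: (tlift_linear (counitl_bilinear (counit H))). Qed.

Let counit_mul0 : counit_mul 0 = 0.
Proof. exact: (lmod_map0 (tlift (counitl_bilinear (counit H)))). Qed.

Lemma trivial_mul_act (u : tensor A A) (b : A) c y :
  trivial_mul (outer_act (tassoc (tens u (b : A^c)))
    (hopf_tens H c y : outer trivial_module (regl A))) =
  counit_mul u * ((c : k) *: y) * b.
Proof.
elim/tensor_ind: u => [|a p q u IH].
  by rewrite tens0l tassoc0 outer_act0l trivial_mul0 counit_mul0 !mul0r.
rewrite tassoc_tensPl outer_actPl trivial_mulP IH outer_act_hopf_tens trivial_mulE.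
rewrite counit_mulP !mulrDl -!scalerAl; congr (_ *: _ + _).
by rewrite /counit_mul tliftE -!scalerAr -!scalerAl scalerA trivial_scaleE mulrC.
Qed.

Definition trivial_tens (t : hopf_bimod H trivial_module) : regl A := trivial_mul t.

(** The counit law [eps(a_1) a_2 = a] turns the action on [k (x) A] into the one on [A]. *)
Fact trivial_tens_linear : linear trivial_tens.
Proof.
move=> t s z; rewrite /trivial_tens [LHS]trivial_mulD; congr (_ + _).
rewrite -[t *: s]/(outer_act (env_comul H t) s) -[RHS]/(regl_act t (trivial_mul s)).
have E p (b : A) : trivial_mul (outer_act (env_comul H (tens p (b : A^c))) s) =
    p * trivial_mul s * b.
  rewrite env_comulE; elim/tensor_ind: s => [|a c y s IH].
    by rewrite outer_act0r trivial_mul0 mulr0 mul0r.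
  rewrite outer_actPr !trivial_mulP mulrDr mulrDl -scalerAr -scalerAl IH; congr (_ *: _ + _).
  by rewrite trivial_mul_act trivial_mulE /counit_mul counitl.
elim/tensor_ind: t => [|a p b t IH].
  by rewrite env_comul0 outer_act0l trivial_mul0 regl_act0.
by rewrite env_comulP outer_actPl trivial_mulP IH E regl_actPl regl_actE.
Qed.
HB.instance Definition _ := GRing.isLinear.Build (env A) (hopf_bimod H trivial_module)
  (regl A) *:%R trivial_tens trivial_tens_linear.

Lemma trivial_tensK :
  cancel trivial_tens (fun y : regl A => hopf_tens H ((1 : k) : trivial_module) y).
Proof.
elim/hopf_tens_ind=> [|c y t IH]; first by rewrite [trivial_tens 0]trivial_mul0; exact: tens0r.
rewrite [trivial_tens _]trivial_mulD hopf_tensDr [X in _ + X]IH trivial_mulE.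
congr (_ + _); rewrite hopf_tensZ; congr (hopf_tens H _ _).
by rewrite kspaceE trivial_scaleE counit_scalar mulr1.
Qed.

Variable Q : proj_resolution trivial_module.
Hypothesis Qdual : forall n, dual_basis (Q n).

(** Exactness is checked on the underlying spaces, where tensoring with [A] is exact; projectivity
    goes through the dual bases. *)
Definition hopf_resolution : proj_resolution (regl A).
Proof.
apply: (@ProjResolution _ (regl A) (fun n => hopf_bimod H (Q n))
  (fun n => hopf_map H (pres_d Q n)) (trivial_tens \o hopf_map H (pres_aug Q))).
- by move=> n; apply: dual_basis_projective; exact: hopf_bimod_dual_basis.
- move=> y; have [q qE] := pres_aug_surj Q ((1 : k) : trivial_module).
  exists (hopf_tens H q y); rewrite /= hopf_mapE qE /trivial_tens.
  by rewrite [LHS]trivial_mulE scale1r.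
- move=> x.
  have E := @tmap_exact k (kspace (Q 1%N)) (kspace (Q 0%N)) (kspace trivial_module)
    (kspace (regl A)) (restr_map _ (pres_d Q 0%N)) (restr_map _ (pres_aug Q))
    (@pres_exact0 _ _ Q) x.
  apply: iff_trans E; split=> [x0|x0].
    by apply: (can_inj trivial_tensK); rewrite [LHS]x0 [RHS]trivial_mul0.
  by rewrite /= [hopf_map _ _ _]x0 [LHS]trivial_mul0.
move=> n x.
exact: (@tmap_exact k (kspace (Q n.+2)) (kspace (Q n.+1)) (kspace (Q n))
  (kspace (regl A)) (restr_map _ (pres_d Q n.+1)) (restr_map _ (pres_d Q n))
  (@pres_exact _ _ Q n) x).
Defined.

Lemma hopf_resolution_dual_basis n : dual_basis (hopf_resolution n).
Proof. exact: hopf_bimod_dual_basis. Qed.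

Lemma hopf_resolution_zero n : is_zero (Q n) -> is_zero (hopf_resolution n).
Proof.
move=> Q0; elim/hopf_tens_ind=> // q y t ->; rewrite addr0 [q]Q0; exact: tens0l.
Qed.

End HopfResolution.

Lemma regl_resolution (k : fieldType) (A : algType k) (H : hopf_structure A) d :
  left_noetherian A -> (forall M : lmodType A, projdim_le M d) ->
  exists P : proj_resolution (regl A),
    (forall n, dual_basis (P n)) /\ forall n, (d < n)%N -> is_zero (P n).
Proof.
move=> noeth gld.
have fgk : fg_module (trivial_module H).
  exists [:: (1 : k) : trivial_module H] => x.
  have -> : x = ((x : k)%:A : A) *: ((1 : k) : trivial_module H) + 0.
    by rewrite addr0 trivial_scaleE counit_scalar mulr1.
  by apply: SpanP; [rewrite mem_head|exact: Span0].
pose Q := fg_resolution noeth (FgLmod fgk).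
have Qdual n : dual_basis (Q n) by exact: fg_resolution_dual_basis.
exists (hopf_resolution Qdual); split=> n; first exact: hopf_resolution_dual_basis.
by move=> dn; apply: hopf_resolution_zero; exact: fg_resolution_zero (gld _) dn.
Qed.

(** * Duals of projective modules *)

Lemma bij_homology_iso (k : fieldType) (U V W U' V' W' : lmodType k)
    (f : {linear U -> V}) (g : {linear V -> W})
    (f' : {linear U' -> V'}) (g' : {linear V' -> W'}) (v : {linear V -> V'}) :
  bijective v -> (forall x, g x = 0 <-> g' (v x) = 0) ->
  (forall x, (exists y, f y = x) <-> exists y, f' y = v x) ->
  lin_iso (homology f g) (homology f' g').
Proof.
move=> /inverse_linear [u [vK uK]] gv fv.
have [||||||F Fb _] := @homology_iso k _ _ _ _ _ _ f g f' g' v u; last by exists F.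
- by move=> x /gv.
- by move=> y; apply/fv; exists y.
- by move=> x; rewrite -{1}[x]uK => /gv.
- by move=> y; apply/fv; rewrite uK; exists y.
- by move=> x _; exists 0; rewrite vK subrr lmod_map0.
- by move=> x _; exists 0; rewrite uK subrr lmod_map0.
Qed.

Lemma hom_addE (k : fieldType) (R : algType k) (M N : lmodType R) (f g : homType M N) x :
  (f + g) x = f x + g x.
Proof. by []. Qed.

Lemma hom_sumE (k : fieldType) (R : algType k) (M N : lmodType R) (I : Type) (s : seq I)
    (F : I -> homType M N) x :
  (\sum_(i <- s) F i) x = \sum_(i <- s) F i x.
Proof.
by elim: s => [|i s IH]; rewrite ?(big_nil, big_cons) // hom_addE IH.
Qed.

(* The right module [Hom_R(P, R)], with [(f r)(x) = f x * th r]. *)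
Definition twisted_dual (k : fieldType) (R : algType k) (th : {lrmorphism R -> R})
  (P : lmodType R) : Type := homType P R^o.

Section TwistedDual.
Variables (k : fieldType) (R : algType k) (th thi : {lrmorphism R -> R}).
Local Notation tdual := (twisted_dual th).
Hypotheses (thK : cancel th thi) (thiK : cancel thi th).

Definition right_mul (t : R) (x : R^o) : R^o := (x : R) * t.
Fact right_mul_linear t : linear (right_mul t).
Proof. by move=> a x y; rewrite /right_mul mulrDl -[RHS]/(a * (x * t) + y * t) mulrA. Qed.
HB.instance Definition _ t :=
  GRing.isLinear.Build R R^o R^o *:%R (right_mul t) (right_mul_linear t).

Section Module.
Variable P : lmodType R.

HB.instance Definition _ := GRing.Zmodule.on (tdual P).

Definition tdual_scale (r : R^c) (f : tdual P) : tdual P := postcomp P (right_mul (th r)) f.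

Lemma tdual_scaleE r (f : tdual P) x :
  (tdual_scale r f : homType P R^o) x = (f : homType P R^o) x * th r :> R.
Proof. by []. Qed.

Fact tdual_scaleA a b f : tdual_scale a (tdual_scale b f) = tdual_scale (a * b) f.
Proof.
apply: hom_ext => x; rewrite !tdual_scaleE -mulrA; congr (_ * _).
exact/esym/(rmorphM th).
Qed.
Fact tdual_scale1 : left_id 1 tdual_scale.
Proof. by move=> f; apply: hom_ext => x; rewrite tdual_scaleE rmorph1 mulr1. Qed.
Fact tdual_scaleDr : right_distributive tdual_scale +%R.
Proof. by move=> a f g; apply: hom_ext => x; rewrite hom_addE !tdual_scaleE hom_addE mulrDl. Qed.
Fact tdual_scaleDl f : {morph tdual_scale^~ f : a b / a + b}.
Proof. by move=> a b; apply: hom_ext => x; rewrite hom_addE !tdual_scaleE rmorphD mulrDr. Qed.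
HB.instance Definition _ := GRing.Zmodule_isLmodule.Build R^c (tdual P)
  tdual_scaleA tdual_scale1 tdual_scaleDr tdual_scaleDl.

(** The roles are exchanged: the forms [f i] generate, and evaluation at [p i] gives the
    coefficients, with [thi] undoing the twist of the action. *)
Lemma tdual_dual_basis : dual_basis P -> dual_basis (tdual P).
Proof.
move=> [n [p [f pf]]].
have [e eE] : exists e : 'I_n -> {linear (tdual P) -> (R^c)^o},
    forall i (g : (tdual P)), e i g = thi ((g : homType P R^o) (p i)) :> R.
  have eP i : linear (fun g : (tdual P) => thi ((g : homType P R^o) (p i)) : (R^c)^o).
    move=> r g h; rewrite hom_addE rmorphD; congr (_ + _).
    apply: etrans (rmorphM thi ((g : homType P R^o) (p i) : R) (th r)) _.
    by congr (_ * _); exact: thK.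
  by exists (fun i => sval (cid (linear_mapP (eP i)))) => i g;
    rewrite (svalP (cid (linear_mapP (eP i)))).
exists n, (f : 'I_n -> (tdual P)), e => g; apply: hom_ext => x.
rewrite hom_sumE [in LHS](pf x) linear_sum; apply: eq_bigr => i _.
by rewrite tdual_scaleE eE thiK linearZ.
Qed.

Lemma tdual_zero : is_zero P -> is_zero (tdual P).
Proof. by move=> P0 f; apply: hom_ext => x; rewrite [x]P0 !linear0. Qed.

End Module.

Definition tdual_map (M N : lmodType R) (d : {linear M -> N}) (f : tdual N) : tdual M :=
  precomp R^o d f.
Fact tdual_map_linear (M N : lmodType R) (d : {linear M -> N}) : linear (tdual_map d).
Proof. by move=> a f g; apply: hom_ext. Qed.
HB.instance Definition _ (M N : lmodType R) (d : {linear M -> N}) := GRing.isLinear.Build R^c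
  (tdual N) (tdual M) *:%R (tdual_map d) (tdual_map_linear d).

Section Evaluation.
Variable M : lmodType R.
Local Notation N := (restr th M).

Section Maps.
Variable P : lmodType R.

Definition rank_one_fun (f : tdual P) (m : M) (x : P) : M :=
  ((f : homType P R^o) x : R) *: m.
Fact rank_one_linear f m : linear (rank_one_fun f m).
Proof. by move=> a x y; rewrite /rank_one_fun linearP scalerDl scalerA. Qed.
HB.instance Definition _ f m :=
  GRing.isLinear.Build R P M *:%R (rank_one_fun f m) (rank_one_linear f m).
Definition rank_one (f : tdual P) (m : M) : homType P M := rank_one_fun f m : {linear P -> M}.

Lemma rank_oneE f m x : rank_one f m x = ((f : homType P R^o) x : R) *: m.
Proof. by []. Qed.

(** A scalar [r] acts as [th r] on the dual and on [restr th M] alike, so balance is the ordinary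
    associativity of [f(x) (th r) m]. *)
Lemma tdual_eval_exists : exists e : {linear tensor_over (tdual P) N -> homType P M},
  forall (f : tdual P) (m : M), e (tens_over f (m : N)) = rank_one f m.
Proof.
apply: (tens_over_lift (b := fun f (m : N) => rank_one f m)).
- by move=> m f g; apply: hom_ext => x; rewrite hom_addE !rank_oneE hom_addE scalerDl.
- by move=> f m n; apply: hom_ext => x; rewrite hom_addE !rank_oneE scalerDr.
- by move=> r f m; apply: hom_ext => x; rewrite !rank_oneE tdual_scaleE restrE scalerA.
move=> c f m; apply: hom_ext => x; rewrite rank_oneE restrE.
have thc : th c%:A = c%:A by rewrite linearZ /= rmorph1.
rewrite [X in _ *: (X *: _)]thc -[RHS]/(c%:A *: rank_one f m x) rank_oneE !scalerA.
by rewrite mulr_algl mulr_algr.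
Qed.

Definition tdual_eval := sval (cid tdual_eval_exists).

Lemma tdual_evalE f m : tdual_eval (tens_over f (m : N)) = rank_one f m.
Proof. exact: (svalP (cid tdual_eval_exists)). Qed.

(** The inverse sends [g] to the sum of the [f_i (x) g(p_i)]. *)
Lemma tdual_eval_bijective : dual_basis P -> bijective tdual_eval.
Proof.
move=> [n [p [f pf]]].
exists (fun g : homType P M => \sum_i tens_over (f i : tdual P) (g (p i) : N)) => [t|g].
  elim/tens_over_ind: t => [|g m t IH].
    by rewrite (lmod_map0 tdual_eval) big1 // => i _; exact: tens_over0r.
  rewrite (lmod_mapD tdual_eval) -[in RHS]IH tdual_evalE.
  have -> : tens_over g (m : N) = \sum_i tens_over (f i : tdual P) (rank_one g m (p i) : N).
    have gE : g = \sum_i (thi ((g : homType P R^o) (p i)) : R^c) *: (f i : tdual P).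
      apply: hom_ext => x; rewrite hom_sumE [in LHS](pf x) linear_sum; apply: eq_bigr => i _.
      rewrite linearZ tdual_scaleE; congr (_ * _); exact/esym/thiK.
    rewrite {1}gE tens_over_suml; apply: eq_bigr => i _.
    rewrite tens_over_balanced restrE; congr tens_over.
    exact: (congr1 (fun r : R => r *: (m : M)) (thiK _)).
  rewrite -big_split; apply: eq_bigr => i _.
  by rewrite hom_addE; exact: tens_overDr.
rewrite (big_morph tdual_eval (lmod_mapD tdual_eval) (lmod_map0 tdual_eval)).
apply: hom_ext => x; rewrite hom_sumE [in RHS](pf x) linear_sum; apply: eq_bigr => i _.
by rewrite tdual_evalE rank_oneE linearZ.
Qed.
End Maps.

Lemma tdual_eval_natural (P P' : lmodType R) (d : {linear P' -> P}) t :
  tdual_eval P' (tensor_over_map N (tdual_map d) t) = precomp M d (tdual_eval P t).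
Proof.
elim/tens_over_ind: t => [|f m t IH].
  rewrite (lmod_map0 (tdual_eval P)) (lmod_map0 (precomp M d)) tensor_over_map0.
  exact: (lmod_map0 (tdual_eval P')).
rewrite (lmod_mapD (tdual_eval P)) tensor_over_mapD (lmod_mapD (tdual_eval P')) IH.
by rewrite tensor_over_mapE !tdual_evalE; exact: hom_ext.
Qed.

End Evaluation.
End TwistedDual.

(** * The dual complex *)

(* Truncated subtraction, recursive on its second argument: [rev_index m 0] is
   convertible to [m] for a variable [m], so that the reversed complex needs no casts. *)
Fixpoint rev_index (m n : nat) {struct n} : nat :=
  match n, m with
  | 0, _ => m
  | n'.+1, 0 => 0
  | n'.+1, m'.+1 => rev_index m' n'
  end.

Lemma rev_index_zero m n : (m <= n)%N -> rev_index m n = 0%N.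
Proof. by elim: n m => [|n IH] [|m] //= /IH. Qed.

Lemma exact_at_zero (S : pzRingType) (U V W : lmodType S) (f : {linear U -> V})
    (g : {linear V -> W}) x : is_zero V -> g x = 0 <-> exists y, f y = x.
Proof.
by move=> V0; rewrite [x]V0 lmod_map0; split=> // _; exists 0; exact: lmod_map0.
Qed.

Section DualComplex.
Variables (k : fieldType) (R : algType k) (th thi : {lrmorphism R -> R}).
Hypotheses (thK : cancel th thi) (thiK : cancel thi th).
Local Notation tdual := (twisted_dual th).
Variables (X : lmodType R) (P : proj_resolution X).
Hypothesis Pdual : forall n, dual_basis (P n).

(* The extra zero module in degree [0] makes the end of the dual complex uniform. *)
Definition shifted (n : nat) : lmodType R :=
  match n with 0 => 'rV[R]_0 | m.+1 => P m end.
Definition shifted_d (n : nat) : {linear shifted n.+1 -> shifted n} :=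
  match n return {linear shifted n.+1 -> shifted n} with
  | 0 => \0
  | m.+1 => pres_d P m
  end.

(** For [m = d.+1], degree [n <= d] holds the dual of [P (d - n)], and higher degrees are zero. A
    general [m] is kept because inductions lower [m] and [n] together. *)
Definition dual_cx (m n : nat) : lmodType R^c := tdual (shifted (rev_index m n)).

Let tdual_lin (V W : lmodType R) (f : {linear V -> W}) : {linear tdual W -> tdual V} :=
  @tdual_map k R th V W f.

Fixpoint dual_cx_d (m n : nat) {struct n} : {linear dual_cx m n.+1 -> dual_cx m n} :=
  match n, m return {linear dual_cx m n.+1 -> dual_cx m n} with
  | 0, 0 => \0
  | 0, m'.+1 => tdual_lin (shifted_d m')
  | n'.+1, 0 => \0
  | n'.+1, m'.+1 => dual_cx_d m' n'
  end.

Lemma shifted0 : is_zero (shifted 0%N).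
Proof. by move=> x; exact: thinmx0. Qed.

Lemma dual_cx_zero m n : (m <= n)%N -> is_zero (dual_cx m n).
Proof. by move=> mn; rewrite /dual_cx rev_index_zero //; apply: tdual_zero; exact: shifted0. Qed.

Lemma dual_cx_dual_basis m n : dual_basis (dual_cx m n).
Proof.
apply: (tdual_dual_basis thK thiK); case: (rev_index m n) => [|i]; last exact: Pdual.
by apply: dual_basis_zero; exact: shifted0.
Qed.

(** Degree [n.+1] holds the dual of [P i] with [i = m - n - 2], so exactness there is the vanishing
    of [Ext^i]. The bound on [i] excludes [m - 1], the one degree where [Ext] may survive. *)
Lemma dual_cx_exact m n : (forall i, (i.+1 < m)%N -> is_zero (Ext_of R^o P i)) ->
  forall x, dual_cx_d m n x = 0 <-> exists y, dual_cx_d m n.+1 y = x.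
Proof.
elim: n m => [|n IH] [|m] Ext0 x.
- by apply: exact_at_zero; exact: (@dual_cx_zero 0%N 0%N).
- case: m Ext0 x => [|m] Ext0 x; first by apply: exact_at_zero; exact: (@dual_cx_zero 1%N 1%N).
  have := Ext0 m (ltnSn _); case: m {Ext0} x => [|m] x /homology_zeroP E.
    split=> [x0|[y <-]]; last by rewrite [y](@dual_cx_zero 2%N 2%N) // !lmod_map0.
    by have [y yE] := E x x0; exists 0; rewrite -yE lmod_map0.
  split=> [x0|[y <-]]; first exact: E.
  by apply: hom_ext => z; rewrite /= pres_dd; exact: linear0.
- by apply: exact_at_zero; exact: (@dual_cx_zero 0%N n.+1).
- by apply: IH => i im; apply: Ext0; exact: ltnW.
Qed.

(** The conditions on [aug] say that [Y] is the cokernel of the last dual differential;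
    [dual_cx d.+1 0] is convertible to the dual of [P d]. *)
Definition dual_resolution (d : nat) (Y : lmodType R^c)
    (aug : {linear tdual (P d) -> Y})
    (aug_surj : forall y, exists x, aug x = y)
    (aug_ker : forall x, aug x = 0 <-> coboundary (x : homType (P d) R^o))
    (Ext0 : forall i, i <> d -> is_zero (Ext_of R^o P i)) : proj_resolution Y.
Proof.
apply: (@ProjResolution _ Y (dual_cx d.+1) (dual_cx_d d.+1) aug) => //.
- by move=> n; apply: dual_basis_projective; exact: dual_cx_dual_basis.
- move=> x; apply: iff_trans (aug_ker x) _.
  case: d aug aug_surj aug_ker Ext0 x => [|d] aug aug_surj aug_ker Ext0 x /=.
    split=> [->|[y <-]]; first by exists 0; exact: lmod_map0.
    by rewrite [y](@dual_cx_zero 1%N 1%N) // lmod_map0.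
  by [].
- move=> n; apply: dual_cx_exact => i; rewrite ltnS => id; apply: Ext0.
  by move=> E; rewrite E ltnn in id.
Defined.

Variable M : lmodType R.
Local Notation N := (restr th M).

(** Position [j.+1] holds the dual of [P i], and evaluation identifies the tensored complex with
    [Hom(P, M)] there. The induction brings [j] to 0. *)
Lemma dual_cx_Ext m j i : m = (j + i).+2 ->
  lin_iso (homology (tensor_over_map N (dual_cx_d m j.+1)) (tensor_over_map N (dual_cx_d m j)))
    (Ext_of M P i).
Proof.
elim: j m => [|j IH] m; last by case: m => // m [E]; exact: (IH m E).
move=> ->.
have eb := @tdual_eval_bijective k R th thi thiK M (P i) (Pdual i).
have nat_d := @tdual_eval_natural k R th M (P i) (P i.+1) (pres_d P i).
have [e' e'K] := @tdual_eval_bijective k R th thi thiK M (P i.+1) (Pdual i.+1).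
(* For [i = 0] the incoming term is the dual of the added zero module, so both complexes have only
   zero as boundary. *)
case: i eb nat_d e' e'K => [|i] eb nat_d e' e'K e'K'.
  apply: (bij_homology_iso eb) => x.
    split=> [x0|x0].
      exact: etrans (esym (nat_d x)) (etrans (congr1 (@tdual_eval k R th M _) x0) (lmod_map0 _)).
    by apply: (can_inj e'K); rewrite [LHS]nat_d [LHS]x0; exact/esym/lmod_map0.
  split=> [[y <-]|[_ /= x0]].
    exists 0; rewrite lmod_map0.
    by rewrite [y](@tensor_over_zero k R _ N (@dual_cx_zero 2%N 2%N isT)) !lmod_map0.
  exists 0; rewrite lmod_map0; apply: (bij_inj eb); rewrite -[RHS]x0; exact: lmod_map0.
have eb' := @tdual_eval_bijective k R th thi thiK M (P i) (Pdual i).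
have nat_d' := @tdual_eval_natural k R th M (P i) (P i.+1) (pres_d P i).
apply: (bij_homology_iso eb) => x.
  split=> [x0|x0].
    exact: etrans (esym (nat_d x)) (etrans (congr1 (@tdual_eval k R th M _) x0) (lmod_map0 _)).
  by apply: (can_inj e'K); rewrite [LHS]nat_d [LHS]x0; exact/esym/lmod_map0.
split=> [[y <-]|[y yE]].
  by exists (tdual_eval th M (P i) y); exact: (esym (nat_d' y)).
case: eb' => f fK Kf; exists (f y); apply: (bij_inj eb).
exact: etrans (nat_d' _) (etrans (congr1 _ (Kf y)) yE).
Qed.

(** In homological degree 0 everything is a cycle; this matches [Hom(P d, M)], all of whose elements
    are cocycles since [P d.+1] is zero. *)
Lemma dual_cx_Ext_top d : is_zero (P d.+1) ->
  lin_iso (homology (tensor_over_map N (dual_cx_d d.+1 0))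
      (\0 : {linear tensor_over (dual_cx d.+1 0%N) N -> tensor_over (dual_cx d.+1 0%N) N}))
    (Ext_of M P d).
Proof.
move=> Pd0.
have eb := @tdual_eval_bijective k R th thi thiK M (P d) (Pdual d).
have Hom0 (x : homType (P d) M) : precomp M (pres_d P d) x = 0.
  by apply: hom_ext => z; rewrite [z]Pd0 !linear0.
case: d Pd0 eb Hom0 => [|d] Pd0 eb Hom0.
  apply: (bij_homology_iso eb) => x; first by split=> // _; exact: Hom0.
  split=> [[y <-]|[_ /= x0]].
    exists 0; rewrite lmod_map0.
    by rewrite [y](@tensor_over_zero k R _ N (@dual_cx_zero 1%N 1%N isT)) !lmod_map0.
  exists 0; rewrite lmod_map0; apply: (bij_inj eb); rewrite -[RHS]x0; exact: lmod_map0.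
have eb' := @tdual_eval_bijective k R th thi thiK M (P d) (Pdual d).
have nat_d' := @tdual_eval_natural k R th M (P d) (P d.+1) (pres_d P d).
apply: (bij_homology_iso eb) => x; first by split=> // _; exact: Hom0.
split=> [[y <-]|[y yE]].
  by exists (tdual_eval th M (P d) y); exact: (esym (nat_d' y)).
case: eb' => f fK Kf; exists (f y); apply: (bij_inj eb).
exact: etrans (nat_d' _) (etrans (congr1 _ (Kf y)) yE).
Qed.

Lemma Ext_of_zero i : is_zero (P i) -> is_zero (Ext_of M P i).
Proof.
move=> P0; have H0 (x : homType (P i) M) : x = 0.
  by apply: hom_ext => z; rewrite [z]P0 !linear0.
case: i P0 H0 => [|i] P0 H0; apply/homology_zeroP => x _; exists 0;
  by rewrite [RHS]H0 lmod_map0.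
Qed.

Variables (d : nat) (Y : lmodType R^c).
Variable (aug : {linear tdual (P d) -> Y}).
Hypothesis aug_surj : forall y, exists x, aug x = y.
Hypothesis aug_ker : forall x, aug x = 0 <-> coboundary (x : homType (P d) R^o).
Hypothesis Ext0 : forall i, i <> d -> is_zero (Ext_of R^o P i).
Hypothesis Pd0 : is_zero (P d.+1).

Lemma van_den_bergh_duality (L : proj_resolution Y) i j : (i + j)%N = d ->
  lin_iso (Ext_of M P i) (Tor_of N L j).
Proof.
move=> ijd; pose D := dual_resolution aug_surj aug_ker Ext0.
apply: lin_iso_trans (Tor_of_comparison N D L j); apply: lin_iso_sym.
case: j ijd => [|j] ijd; last by apply: dual_cx_Ext; rewrite -ijd addnS addnC.
rewrite addn0 in ijd; rewrite ijd; exact: dual_cx_Ext_top.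
Qed.

Lemma Tor_of_zero (L : proj_resolution Y) j : (d < j)%N -> is_zero (Tor_of N L j).
Proof.
move=> dj; pose D := dual_resolution aug_surj aug_ker Ext0.
apply: lin_iso_is_zero (Tor_of_comparison N L D j) _.
have T0 : is_zero (tensor_over (D j) N).
  by apply: tensor_over_zero; exact: dual_cx_zero.
case: j dj T0 => // j dj T0; apply/homology_zeroP => x _; exists 0.
by rewrite [RHS]T0 lmod_map0.
Qed.

End DualComplex.

(** * The Nakayama automorphism *)

Section Nakayama.
Variables (k : fieldType) (A : algType k) (nu : alg_aut A).

(** Multiplying cochains on the right by [b (x) a] becomes [y |-> a y nu(b)] in [^1 A^nu]. Through
    [th], the scalar [a (x) b] multiplies by [nu^-1(a) (x) b], which becomes [y |-> b y a], the
    right action on [regr A]. *)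
Let th : {lrmorphism env A -> env A} := env_map (aut_inv nu) idfun.
Let thi : {lrmorphism env A -> env A} := env_map nu idfun.

Lemma env_mapE (s t : {lrmorphism A -> A}) a b :
  env_map s t (tens a (b : A^c)) = tens (s a) (t b : A^c).
Proof. exact: tmapE. Qed.

Lemma env_map_cancel (s t : {lrmorphism A -> A}) : cancel s t ->
  cancel (env_map s idfun) (env_map t idfun).
Proof.
move=> st x; change (tmap t (op_mor (idfun : {lrmorphism A -> A}))
  (tmap s (op_mor (idfun : {lrmorphism A -> A})) x) = x).
elim/tensor_ind: x => [|c a b x IH]; first by rewrite !tmap0.
by rewrite !tmapP IH !tmapE /= st.
Qed.

Variables (P : proj_resolution (regl A)) (d : nat).
Hypothesis Pd0 : is_zero (P d.+1).
Variable phi : {linear HH_coh d (env A)^o -> kspace (twist idfun nu (regl A))}.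
Hypothesis phi_bij : bijective phi.
Hypothesis phiM : forall (a b : A) (x : HH_coh d (env A)^o),
  phi (Ext_map (M := regl A) (env_mulr (tens b (a : A^c))) x) =
  tens a (b : A^c) *: (phi x : twist idfun nu (regl A)).

(** A cochain goes to its class on [P], then by comparison to the free resolution, where [phi] is
    given. *)
Lemma nakayama_augmentation : exists aug : {linear twisted_dual th (P d) -> regr A},
  (forall y, exists x, aug x = y) /\
  forall x, aug x = 0 <-> coboundary (x : homType (P d) (env A)^o).
Proof.
have [f [g [cf cg hfg hgf]]] := comparison P (free_resolution (regl A)).
have [F Fb FE] := @Ext_of_comparison _ _ _ (env A)^o _ _ _ _ d cf cg hfg hgf.
have cocycle (x : homType (P d) (env A)^o) : precomp _ (pres_d P d) x = 0.
  by apply: hom_ext => z; rewrite [z]Pd0 !linear0.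
(* [h] is picked by choice, but a cocycle has only one class, whence linearity. *)
have [h hE] : exists h : homType (P d) (env A)^o -> Ext_of (env A)^o P d,
    forall x, ext_represents x (h x).
  by have [h hE] := choice (fun x => cocycle_represents (cocycle x)); exists h.
have h_uniq x z : ext_represents x z -> h x = z.
  move=> xz; apply/(ext_represents_eqP (hE x) xz); rewrite subrr.
  by case: (d) => [|d'] //; exists 0; exact: lmod_map0.
have hP c x y : h (c *: x + y) = c *: h x + h y.
  by apply: h_uniq; exact: ext_represents_linear.
have h0 : h 0 = 0 by apply: (addrI (h 0)); have := hP 1 0 0; rewrite !scale1r !addr0.
pose al (x : twisted_dual th (P d)) : A := phi (F (h x)).
have phiZ c z : phi (c *: z) = c *: (phi z : A) :> A.
  rewrite linearZ -[LHS]/(regl_act (env_map idfun nu c%:A) (phi z)).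
  have -> : env_map idfun nu c%:A = c%:A by rewrite linearZ /= rmorph1.
  exact: (kspace_reglE c (phi z : kspace (regl A))).
have alP c x y : al (c *: (x : homType (P d) (env A)^o) + y) = c *: al x + al y.
  by rewrite /al hP (lmod_mapP F) (lmod_mapD phi) phiZ.
have alD x y : al (x + y) = al x + al y.
  by have := alP 1 x y; rewrite !scale1r.
have al0 : al 0 = 0 by apply: (addrI (al 0)); rewrite -alD !addr0.
have alM (a b : A) x : al (tdual_scale (tens a (b : A^c)) x) = b * al x * a.
  have -> : al (tdual_scale (tens a (b : A^c)) x) =
      phi (Ext_map (M := regl A) (env_mulr (tens (aut_inv nu a) (b : A^c)))
        (F (h x) : HH_coh d (env A)^o)).
    (* Comparison precomposes cochains and the action postcomposes them, so the two commute. *)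
    have hx : ext_represents
        (postcomp _ (env_mulr (tens (aut_inv nu a) (b : A^c))) (precomp _ (g d) x))
        (Ext_of_map (env_mulr (tens (aut_inv nu a) (b : A^c)))
        (F (h x) : HH_coh d (env A)^o)).
      by apply: ext_represents_map; exact: FE.
    rewrite /al; congr (phi _).
    have hy := FE _ _ (hE (tdual_scale (tens a (b : A^c)) x)).
    apply/(ext_represents_eqP hy hx).
    have -> : precomp (env A)^o (g d) (tdual_scale (tens a (b : A^c)) x) =
        postcomp _ (env_mulr (tens (aut_inv nu a) (b : A^c))) (precomp (env A)^o (g d) x).
      apply: hom_ext => z.
      rewrite -[LHS]/(((x : homType (P d) (env A)^o) (g d z) : env A) * th (tens a (b : A^c))).
      by rewrite env_mapE.
    by rewrite subrr; case: (d) => [|d'] //; exists 0; exact: lmod_map0.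
  rewrite phiM.
  by rewrite -[LHS]/(regl_act (env_map idfun nu (tens b (aut_inv nu a : A^c))) (al x))
    env_mapE regl_actE /= aut_invK.
have [|aug augE] := @linear_mapP _ (twisted_dual th (P d)) (regr A) al.
  move=> r x y; rewrite [LHS]alD; congr (_ + _).
  rewrite -[r *: x]/(tdual_scale r x) -[RHS]/(regr_act r (al x)).
  elim/tensor_ind: r => [|c a b r IH].
    have -> : tdual_scale 0 x = 0.
      by apply: hom_ext => z; rewrite tdual_scaleE (lmod_map0 th) mulr0.
    by rewrite al0 regr_act0.
  have -> : tdual_scale (c *: tens a b + r) x =
      c *: (tdual_scale (tens a b) x : homType (P d) (env A)^o) + tdual_scale r x.
    apply: hom_ext => z; rewrite hom_addE !tdual_scaleE (lmod_mapP th) mulrDr -scalerAr.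
    by congr (_ + _); rewrite -[RHS]/(c%:A * _) mulr_algl.
  by rewrite alP IH alM regr_actPl regr_actE.
exists aug; split=> [y|x].
  have [phi' _ phiK] := phi_bij; have [F' _ FK] := Fb.
  have [x xE] := ext_represents_exists (F' (phi' y)).
  by exists x; rewrite augE /al (h_uniq _ _ xE) FK phiK.
rewrite augE.
have -> : al x = 0 <-> h x = 0.
  split=> [x0|x0]; last by rewrite /al x0 (lmod_map0 F) (lmod_map0 phi).
  apply: (bij_inj Fb); apply: (bij_inj phi_bij); rewrite [LHS]x0 (lmod_map0 F).
  exact/esym/(lmod_map0 phi).
have r0 : ext_represents 0 (0 : Ext_of (env A)^o P d) by rewrite -[X in ext_represents _ X]h0.
by rewrite (ext_represents_eqP (hE x) r0) subr0.
Qed.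
End Nakayama.

Theorem corollary0p4 (k : closedFieldType) (A : algType k) (H : hopf_structure A)
    (d : nat) (nu : alg_aut A) :
  noetherian A ->
  AS_gorenstein (counit H) ->
  gldim_eq A d ->
  bijective (antipode H) ->
  is_nakayama nu d ->
  forall (M : lmodType (env A)) (i : int),
    lin_iso (HH_coh i M) (HH_hom (d%:Z - i) (twist (aut_inv nu) idfun M)).
Proof.
move=> [noeth _] _ [gld _] _ [Ext0 [phi [phi_bij phiM]]] M i.
have [P [Pdual Pzero]] := regl_resolution H noeth gld.
have [aug [aug_surj aug_ker]] := nakayama_augmentation (Pzero d.+1 (ltnSn d)) phi_bij phiM.
have Ecmp (N : lmodType (env A)) j :
    lin_iso (Ext_of N (free_resolution (regl A)) j) (Ext_of N P j).
  have [f [g [cf cg hfg hgf]]] := comparison (free_resolution (regl A)) P.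
  by have [F Fb _] := @Ext_of_comparison _ _ _ N _ _ _ _ j cf cg hfg hgf; exists F.
have thK : cancel (env_map (aut_inv nu) idfun) (env_map nu idfun).
  exact/env_map_cancel/aut_invK.
have thiK : cancel (env_map nu idfun) (env_map (aut_inv nu) idfun).
  exact/env_map_cancel/aut_funK.
have E0 j : j <> d -> is_zero (Ext_of (env A)^o P j).
  by move=> jd; apply: lin_iso_is_zero (lin_iso_sym (Ecmp _ j)) _; exact: Ext0.
have rV0 : is_zero 'rV[k]_0 by move=> x; exact: thinmx0.
(* For [i = -(n + 1)] cohomology is zero by definition, and [Tor] sits in degree [d + n + 1], beyond
   the length of the dual resolution. *)
case: i => n; last first.
  apply: lin_iso_zero => //; rewrite NegzE opprK -PoszD /HH_hom /Tor.
  apply: (Tor_of_zero thK thiK Pdual aug_surj aug_ker E0).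
  by rewrite addnS ltnS leq_addr.
have [nd|dn] := leqP n d.
  have -> : d%:Z - n%:Z = Posz (d - n) by rewrite subzn.
  apply: lin_iso_trans (Ecmp M n) _.
  exact: (van_den_bergh_duality thK thiK Pdual M aug_surj aug_ker E0 (Pzero _ (ltnSn d))
    (free_resolution (regr A)) (subnKC nd)).
(* For [n > d] homology is zero by its negative degree, and [Ext] because [P n] is zero. *)
have -> : d%:Z - n%:Z = Negz (n - d).-1.
  by rewrite NegzE prednK ?subn_gt0 // -subzn ?opprB // ltnW.
apply: lin_iso_zero; last exact: rV0.
apply: lin_iso_is_zero (Ecmp M n) _; apply: Ext_of_zero; exact: Pzero.
Qed.
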